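(* Let $\mathbb F_q$ be a finite field of odd characteristic and let $d\in\mathbb F_q[x]$ be square-free of degree $D\ge3$. Then for every $t\in\mathbb R$, $$\big|L(\tfrac12+it,\chi_d)\big|<4\,|d|^{\frac{10}{\log D}}.$$
   Context: $|d|=q^{\deg d}$. $\chi_d(m)=(d/m)$ is the Kronecker symbol for monic $m$ (completely multiplicative in $m$, $(d/1)=1$, and for $p$ monic irreducible $(d/p)=0$ if $p\mid d$, else $\pm1$ according as $d$ is a square mod $p$), and $L(s,\chi_d)=\sum_{m\ \text{monic}}\chi_d(m)|m|^{-s}$, which for such $d$ is a polynomial in $q^{-s}$ (hence entire). *)

(* Defs.v *)
From HB Require Import structures.
From mathcomp Require Import all_boot all_order all_algebra.
From mathcomp Require Import all_classical all_reals all_analysis.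
Set Implicit Arguments. Unset Strict Implicit. Unset Printing Implicit Defensive.
Import Order.TTheory GRing.Theory Num.Theory numFieldNormedType.Exports.
Local Open Scope ring_scope.

Section Defs.
Variable F : finFieldType.

Definition squarefree (d : {poly F}) : Prop :=
  d != 0 /\ forall p : {poly F}, (1 < size p)%N -> ~~ (p * p %| d).

Definition legendre_at (d p : {poly F}) : int :=
  if p %| d then 0
  else if `[< exists y : {poly F}, p %| y ^+ 2 - d >] then 1 else -1.

(* chi is the Kronecker symbol chi_d(m) = (d/m) on monic m:
   completely multiplicative on monic polynomials, chi 1 = 1, and equal to
   the Legendre value on monic irreducibles.  (This determines chi on all
   monic polynomials by unique factorization.) *)
Definition is_kronecker (d : {poly F}) (chi : {poly F} -> int) : Prop :=
  [/\ chi 1 = 1,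
      forall m n : {poly F}, m \is monic -> n \is monic ->
        chi (m * n) = chi m * chi n
    & forall p : {poly F}, p \is monic -> irreducible_poly p ->
        chi p = legendre_at d p].

Definition monic_of (n : nat) (c : {ffun 'I_n -> F}) : {poly F} :=
  'X^n + \sum_(i < n) c i *: 'X^i.

Variable R : realType.

Definition absq (n : nat) : R := ((#|F| ^ n)%N)%:R.

(* Partial sums over monic m with deg m < N of chi(m) |m|^{-s}, s = sigma + i t,
   using |m|^{-s} = exp(-s ln|m|)
                  = exp(-sigma ln|m|) (cos(t ln|m|) - i sin(t ln|m|)).
   Real and imaginary parts separately. *)
Definition Lpartial_re (chi : {poly F} -> int) (sigma t : R) (N : nat) : R :=
  \sum_(n < N) \sum_(c : {ffun 'I_n -> F})
     (chi (monic_of c))%:~R * expR (- sigma * ln (absq n))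
       * cos (t * ln (absq n)).

Definition Lpartial_im (chi : {poly F} -> int) (sigma t : R) (N : nat) : R :=
  \sum_(n < N) \sum_(c : {ffun 'I_n -> F})
     - ((chi (monic_of c))%:~R * expR (- sigma * ln (absq n))
       * sin (t * ln (absq n))).

(* L(s, chi) = sum over monic m of chi(m)|m|^{-s}: limit of the partial sums
   ordered by degree (for the d considered, the sum is finite, i.e. the
   partial sums are eventually constant, so this is the entire function). *)
Definition L_re (chi : {poly F} -> int) (sigma t : R) : R :=
  limn (Lpartial_re chi sigma t).
Definition L_im (chi : {poly F} -> int) (sigma t : R) : R :=
  limn (Lpartial_im chi sigma t).

Definition L_abs (chi : {poly F} -> int) (sigma t : R) : R :=
  Num.sqrt (L_re chi sigma t ^+ 2 + L_im chi sigma t ^+ 2).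

End Defs.

(* Main.v *)
Require Import Defs.
From HB Require Import structures.
From mathcomp Require Import all_boot all_order all_algebra.
From mathcomp Require Import all_field complex.
From mathcomp Require Import ring lra zify.
From mathcomp Require Import all_classical all_reals all_analysis.
Import Order.TTheory GRing.Theory Num.Theory numFieldNormedType.Exports.
Set Implicit Arguments. Unset Strict Implicit. Unset Printing Implicit Defensive.
Local Open Scope ring_scope.

(* Let q = #|F|, D = deg d, u = q^(-s).  By Euler's criterion (d/m) is the
   quadratic character of the resultant of m and d, so it is multiplicative in m
   and, for fixed degree, depends only on m mod d; hence L = sum_n A_n u^n is a
   polynomial of degree < D, and counting the roots of m with multiplicity gives
   n A_n = sum_(1 <= k <= n) S_k A_(n-k) with S_k = sum_x chi_k(d(x)) over the
   field with q^k elements.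
   Stepanov's method over the field with P^2 elements, P = q^j, bounds S_(2j)
   by O(P): on the points where d^((P^2-1)/2) = eps, a polynomial
   A = sum c_(b,s,i) d^(b(P+1)/2) X^(s+iP) satisfies
   A^P = sum c_(b,s,i) eps^b d^(b(P+1)/2) X^(sP+i), which linear algebra makes
   identically zero while A <> 0.  Hence every inverse root of L has modulus at
   most q^(1/2).
   Finally, for |w| <= 1, ln|1 - w| <= (5/2)/(N+1) - Re sum_(k <= N) kappa_k w^k
   with 0 <= kappa_k <= 1.  Summing over the inverse roots and using only the
   trivial bound |S_k| <= q^k for k <= N = floor(ln D / ln q) gives
   ln|L| <= 10 D ln q / ln D. *)

(** * Finite subfields of an algebraic closure *)

(** One algebraic closure [K] replaces a tower of finite fields: the field with q^k elements is the
    fixed set of the k-th Frobenius, so polynomials over [F], their roots and all norms live in one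
    place. The estimate of S_(2j) enters only through its growth rate as j tends to infinity: any
    constant, any starting point and the even indices alone suffice, hence the crude parameters in
    Stepanov's method. Over a field of square order P^2, raising to the power P exchanges X and X^P
    on points, and simple zeros of A already give the right count because deg A is about P^2/2; no
    derivatives enter. A sharp cut-off of the series of ln|1 - w| would leave an error of order 1
    for w at distance about 1/N from 1. The Fejer weights 1 - k/(N+1), damped by a radius r < 1,
    reduce it to O(1/N) from above. At most D inverse roots lose (5/2) D/(N+1), which is at most
    (5/2) D ln q/ln D; the trivial bounds contribute at most N sqrt(D), which is at most (15/2) D ln
    q/ln D. The two constants add up to 10. *)

Section Frobenius.
Variables (F : finFieldType) (K : closedFieldType) (iota : {rmorphism F -> K}).
Local Notation q := #|F|.
Local Notation "p ^io" := (map_poly iota p) (at level 2, format "p ^io").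

Lemma card_gt1 : (1 < q)%N.
Proof. exact: finNzRing_gt1. Qed.

Lemma card_pchar : exists p n, [/\ p \in [pchar K], prime p, (0 < n)%N & q = (p ^ n)%N].
Proof.
have [p p_pr pF] := finPcharP F.
exists p, (logn p q); split=> //; first by rewrite (fmorph_pchar iota).
  rewrite lt0n; apply/eqP => H; move: card_gt1.
  by have := card_pprimeChar pF; rewrite /= H => ->.
exact: card_pprimeChar pF.
Qed.

Lemma card_pnat : [pchar K].-nat q.
Proof.
have [p [n [pK p_pr _ ->]]] := card_pchar.
by rewrite pnatX (eq_pnat _ (pcharf_eq pK)) pnat_id.
Qed.

Lemma card_exp_pnat k : [pchar K].-nat (q ^ k)%N.
Proof. by rewrite pnatX card_pnat. Qed.

Definition Frob k (x : K) := x ^+ (q ^ k)%N.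

Lemma FrobB k : zmod_morphism (Frob k).
Proof.
by move=> x y; rewrite /Frob exprDn_pchar ?card_exp_pnat // exprNn_pchar ?card_exp_pnat.
Qed.
Lemma FrobM k : monoid_morphism (Frob k).
Proof. by split=> [|x y]; rewrite /Frob ?expr1n ?exprMn. Qed.
HB.instance Definition _ k := GRing.isZmodMorphism.Build K K (Frob k) (@FrobB k).
HB.instance Definition _ k := GRing.isMonoidMorphism.Build K K (Frob k) (@FrobM k).

Lemma Frob0 x : Frob 0 x = x. Proof. by rewrite /Frob expn0 expr1. Qed.
Lemma Frob_add k l x : Frob (k + l) x = Frob k (Frob l x).
Proof. by rewrite /Frob -exprM mulnC -expnD. Qed.
Lemma Frob_mul k j x : Frob k x = x -> Frob (j * k) x = x.
Proof. by move=> H; elim: j => [|j IH]; rewrite ?Frob0 // mulSn Frob_add IH. Qed.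
Lemma Frob_iota k a : Frob k (iota a) = iota a.
Proof.
elim: k => [|k IH]; first by rewrite Frob0.
by rewrite -addn1 Frob_add {2}/Frob expn1 -rmorphXn expf_card.
Qed.
Lemma Frob_inj k : injective (Frob k). Proof. exact: fmorph_inj. Qed.

Lemma Frob_horner k (p : {poly F}) x : Frob k (p^io).[x] = (p^io).[Frob k x].
Proof.
rewrite -[LHS]horner_map -map_poly_comp; congr _.[_].
by apply: eq_map_poly => a /=; rewrite Frob_iota.
Qed.

Lemma fixed_in_F x : Frob 1 x = x -> exists a, x = iota a.
Proof.
move=> Hx; have [a /eqP Ha|H] := pickP (fun a => x == iota a); first by exists a.
have := @max_poly_roots K ('X^q - 'X) (x :: [seq iota a | a <- enum F]).
have sz : size ('X^q - 'X : {poly K}) = q.+1.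
  by rewrite size_polyDl ?size_polyXn // size_polyN size_polyX ltnS card_gt1.
rewrite sz /= size_map -cardE ltnn; move=> Habs; have // : false; apply: Habs.
- by rewrite -size_poly_eq0 sz.
- apply/andP; split.
    by move: Hx; rewrite /Frob expn1 /root !hornerE => ->; rewrite subrr.
  apply/allP => _ /mapP[a _ ->].
  by rewrite /root !hornerE -rmorphXn expf_card subrr.
- rewrite map_inj_uniq ?enum_uniq ?andbT; last exact: fmorph_inj.
  by apply/mapP => -[a _ /eqP]; rewrite H.
Qed.

Lemma fixed_poly (g : {poly K}) : map_poly (Frob 1) g = g -> exists h : {poly F}, g = h^io.
Proof.
move=> Hg.
have H i : exists a, g`_i == iota a.
  have [|a Ha] := @fixed_in_F g`_i; last by exists a; rewrite Ha.
  by rewrite -{2}Hg coef_map.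
exists (\poly_(i < size g) xchoose (H i)).
apply/polyP => i; rewrite coef_map coef_poly.
case: ltnP => Hi; last by rewrite nth_default //= raddf0.
exact: (eqP (xchooseP (H i))).
Qed.

Lemma Fixed_ex k : {s : seq K | (0 < k)%N -> [/\ uniq s, size s = (q ^ k)%N & forall x, (x \in s) = (Frob k x == x)]}.
Proof.
have [s Hs] := closed_field_poly_normal ('X^(q ^ k) - 'X : {poly K}).
exists s => k0.
have qk1 : (1 < q ^ k)%N by rewrite -(exp1n k) ltn_exp2r // card_gt1.
have sz : size ('X^(q ^ k) - 'X : {poly K}) = (q ^ k).+1.
  by rewrite size_polyDl ?size_polyXn // size_polyN size_polyX ltnS.
have mon : lead_coef ('X^(q ^ k) - 'X : {poly K}) = 1.
  by rewrite lead_coefDl ?lead_coefXn // size_polyXn size_polyN size_polyX ltnS.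
move: Hs; rewrite mon scale1r => Hs.
split.
- rewrite -separable_prod_XsubC -Hs separable_poly.unlock derivB poly.derivXn poly.derivX.
  have -> : 'X^((q ^ k)%N.-1) *+ (q ^ k)%N = 0 :> {poly K}.
    apply/polyP => i; rewrite coefMn coef0 -mulr_natr.
    suff -> : (q ^ k)%:R = 0 :> K by rewrite mulr0.
    have [p [n [pK p_pr n0 ->]]] := card_pchar.
    by apply/eqP; rewrite -(dvdn_pcharf pK) -expnM dvdn_exp // muln_gt0 k0 n0.
  by rewrite sub0r -(scaleN1r 1) coprimepZr ?oppr_eq0 ?oner_eq0 ?coprimep1.
- by apply: succn_inj; rewrite -(size_prod_XsubC s id) -Hs sz.
- by move=> x; rewrite -root_prod_XsubC -Hs /root !hornerE /Frob subr_eq0.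
Qed.

(* The subfield with q^k elements; junk for k = 0, where 'X^(q^k) - 'X = 0. *)
Definition Fixed k := sval (Fixed_ex k).
Lemma Fixed_uniq k : (0 < k)%N -> uniq (Fixed k).
Proof. by rewrite /Fixed; case: (Fixed_ex k) => s H /H[]. Qed.
Lemma size_Fixed k : (0 < k)%N -> size (Fixed k) = (q ^ k)%N.
Proof. by rewrite /Fixed; case: (Fixed_ex k) => s H /H[]. Qed.
Lemma mem_Fixed k x : (0 < k)%N -> (x \in Fixed k) = (Frob k x == x).
Proof. by rewrite /Fixed; case: (Fixed_ex k) => s H /H[]. Qed.

(* When x^(q^k) = x this is a power of the minimal polynomial of x over F, and
   k need not be the exact degree of x. *)
Definition conj_poly k (x : K) : {poly K} := \prod_(i < k) ('X - (Frob i x)%:P).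

Lemma conj_poly_monic k x : conj_poly k x \is monic. Proof. exact: monic_prod_XsubC. Qed.
Lemma size_conj_poly k x : size (conj_poly k x) = k.+1.
Proof. by rewrite /conj_poly -(big_mkord xpredT (fun i => 'X - (Frob i x)%:P)) size_prod_XsubC size_iota subn0. Qed.

Lemma conj_poly_fixed k x : Frob k x = x -> exists h : {poly F}, conj_poly k x = h^io.
Proof.
move=> Hx; apply: fixed_poly.
case: k Hx => [|k] Hx; first by rewrite /conj_poly big_ord0 rmorph1.
rewrite rmorph_prod /= /conj_poly [RHS]big_ord_recl [LHS]big_ord_recr /= mulrC.
rewrite rmorphB /= map_polyX map_polyC /= -Frob_add add1n Hx Frob0; congr (_ * _).
by apply: eq_bigr => i _; rewrite rmorphB /= map_polyX map_polyC /= -Frob_add.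
Qed.

Lemma conj_polyE k x : conj_poly k x = \prod_(y <- [seq Frob i x | i <- seq.iota 0 k]) ('X - y%:P).
Proof. by rewrite big_map /conj_poly -[seq.iota 0 k](congr1 (seq.iota 0) (subn0 k)) big_mkord. Qed.

Lemma conj_polyD a b x : Frob a x = x -> conj_poly (a + b) x = conj_poly a x * conj_poly b x.
Proof.
move=> Hx; rewrite /conj_poly big_split_ord /=; congr (_ * _).
by apply: eq_bigr => i _; rewrite addnC Frob_add Hx.
Qed.

Lemma conj_poly_mul e j x : Frob e x = x -> conj_poly (j * e) x = conj_poly e x ^+ j.
Proof.
move=> Hx; elim: j => [|j IH]; first by rewrite /conj_poly big_ord0.
by rewrite mulSn conj_polyD // IH exprS.
Qed.

(** The degree [e] of [x] over [F] is encoded as its exact period under Frobenius, and the minimal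
    polynomial as the product over that orbit. *)
Definition is_minpoly (x : K) (e : nat) (p : {poly F}) :=
  [/\ (0 < e)%N, Frob e x = x, forall k, Frob k x = x -> (e %| k)%N & p^io = conj_poly e x].

(** Frobenius sends roots of [h] to roots of [h], so two of the first [size h] iterates of [x]
    coincide. Injectivity turns the repetition into a period; the least one divides all others. *)
Lemma minpoly_ex (h : {poly F}) x : h != 0 -> root (h^io) x -> exists e p, is_minpoly x e p.
Proof.
move=> h0 rh.
have [k k0 Hk] : exists2 k, (0 < k)%N & Frob k x == x.
  have : ~~ uniq [seq Frob i x | i <- seq.iota 0 (size h)].
    apply/negP => U; have := @max_poly_roots _ (h^io) _ _ _ U.
    rewrite map_poly_eq0 size_map_poly size_map size_iota ltnn => H.
    have // : false; apply: H => //; apply/allP => _ /mapP[i _ ->].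
    by rewrite /root -Frob_horner (rootP rh) rmorph0.
  case/(uniqPn 0) => i [j [ij]]; rewrite size_map size_iota => jh.
  rewrite !(nth_map 0%N) ?size_iota // ?(ltn_trans ij) // !nth_iota ?(ltn_trans ij) // !add0n => E.
  exists (j - i)%N; first by rewrite subn_gt0.
  by rewrite eq_sym; apply/eqP/(@Frob_inj i); rewrite E -Frob_add subnKC // ltnW.
have [e /andP[e0 /eqP He] Hmin] := ex_minnP (ex_intro (fun k => (0 < k)%N && (Frob k x == x)) k (introT andP (conj k0 Hk))).
have [p Hp] := conj_poly_fixed He.
exists e, p; split=> // l Hl; rewrite /dvdn; apply: contraT; rewrite -lt0n => r0.
have : (0 < l %% e)%N && (Frob (l %% e)%N x == x).
  rewrite r0 /=; move: Hl; rewrite {1}(divn_eq l e) addnC Frob_add => Hl.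
  by rewrite -{2}Hl Frob_mul.
by move/Hmin; rewrite leqNgt ltn_mod e0.
Qed.

(** * Divisibility by a minimal polynomial *)

Section MinPoly.
Variables (x : K) (e : nat) (p : {poly F}).
Hypothesis Hp : is_minpoly x e p.

Lemma minp_conj_uniq : uniq [seq Frob i x | i <- seq.iota 0 e].
Proof.
have [e0 He Hmin _] := Hp.
rewrite map_inj_in_uniq ?iota_uniq //.
suff H i j : (i <= j)%N -> (j < e)%N -> Frob i x = Frob j x -> i = j.
  move=> i j; rewrite !mem_iota !add0n => /andP[_ Hi] /andP[_ Hj] E.
  by case: (leqP i j) => ij; [apply: H | apply/esym/H => //; apply: ltnW].
move=> ij je E.
have : (e %| j - i)%N by apply: Hmin; apply: (@Frob_inj i); rewrite -Frob_add subnKC.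
have lt : (j - i < e)%N by apply: leq_ltn_trans je; apply: leq_subr.
rewrite /dvdn modn_small // subn_eq0 => ji.
by apply/eqP; rewrite eqn_leq ij.
Qed.

Lemma minp_monic : p \is monic.
Proof. by have [_ _ _ E] := Hp; rewrite -(map_monic iota) E conj_poly_monic. Qed.

Lemma minp_size : size p = e.+1.
Proof. by have [_ _ _ E] := Hp; rewrite -(size_map_poly iota) E size_conj_poly. Qed.

Lemma minp_root i : root (p^io) (Frob i x).
Proof.
have [e0 He _ E] := Hp; rewrite /root -Frob_horner.
suff /rootP -> : root (p^io) x by rewrite rmorph0.
rewrite E conj_polyE root_prod_XsubC; apply/mapP; exists 0%N; last by rewrite Frob0.
by rewrite mem_iota.
Qed.

Lemma minp_mup : mup x (p^io) = 1%N.
Proof.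
have [e0 He _ E] := Hp; rewrite E conj_polyE mu_prod_XsubC count_uniq_mem ?minp_conj_uniq //.
rewrite (_ : _ \in _) //; apply/mapP; exists 0%N; last by rewrite Frob0.
by rewrite mem_iota.
Qed.

Lemma minp_dvd (h : {poly F}) : (p %| h) = root (h^io) x.
Proof.
have [e0 He _ E] := Hp; apply/idP/idP => [|rh].
  by rewrite -(dvdp_map iota) => /dvdpP[g ->]; rewrite rootM -{2}[x]Frob0 minp_root orbT.
rewrite -(dvdp_map iota) E conj_polyE; apply: uniq_roots_dvdp.
  by apply/allP => _ /mapP[i _ ->]; rewrite /root -Frob_horner (rootP rh) rmorph0.
by rewrite uniq_rootsE minp_conj_uniq.
Qed.

Lemma minp_eq (h : {poly F}) : h \is monic -> irreducible_poly h -> root (h^io) x -> h = p.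
Proof.
move=> mh [_ ih]; rewrite -minp_dvd => /ih H.
apply/esym/eqP; rewrite -eqp_monic ?minp_monic //; apply: H.
by rewrite minp_size; case: Hp; case: (e).
Qed.

Lemma minp_exp_dvd (h : {poly F}) j : h != 0 -> (p ^+ j %| h) = (j <= mup x (h^io))%N.
Proof.
have p0 : p != 0 by apply: monic_neq0 minp_monic.
have px : ~~ (size p == 1)%N by rewrite minp_size eqSS -lt0n; case: Hp.
elim: j h => [|j IH] h h0; first by rewrite expr0 dvd1p.
have [|Hr] := boolP (root (h^io) x).
  rewrite -minp_dvd => /dvdpP[g E]; move: h0; rewrite E mulf_eq0 negb_or => /andP[g0 _].
  rewrite exprSr dvdp_mul2r // IH // rmorphM mupM ?map_poly_eq0 //=.
  by rewrite minp_mup addn1.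
rewrite mupNroot // leqn0 /=; apply: contraNF Hr; rewrite -minp_dvd; apply: dvdp_trans.
by rewrite exprS dvdp_mulr.
Qed.

Lemma minp_conj_poly_dvd (h : {poly F}) k : h != 0 ->
  Frob k x = x -> (conj_poly k x %| h^io) = (k %/ e <= mup x (h^io))%N.
Proof.
move=> h0; have [e0 He Hm E] := Hp; move/Hm => /dvdnP[j ->].
by rewrite mulnK // conj_poly_mul // -E -rmorphXn dvdp_map minp_exp_dvd.
Qed.

(* F[x] has q^e elements, as many as the field fixed by the e-th Frobenius. *)
Lemma minp_eval_surj w : Frob e w = w -> exists v : {poly F}, w = (v^io).[x].
Proof.
move=> Hw; have [e0 He Hm E] := Hp.
pose ev (c : {ffun 'I_e -> F}) : K := ((\sum_(i < e) c i *: 'X^i)^io).[x].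
have sz (c : {ffun 'I_e -> F}) : (size (\sum_(i < e) c i *: 'X^i)%R < size p)%N.
  rewrite minp_size ltnS; apply: leq_trans (size_sum _ _ _) _.
  apply/bigmax_leqP => i _; apply: leq_trans (size_scale_leq _ _) _.
  by rewrite size_polyXn.
have ev_inj : injective ev.
  move=> c1 c2 /eqP; rewrite /ev -subr_eq0 -hornerN -hornerD -rmorphN -rmorphD /= -/(root _ _) -minp_dvd.
  rewrite -sumrB => D; apply/ffunP => i.
  have Z : \sum_(i < e) (c1 i *: 'X^i - c2 i *: 'X^i) = 0.
    apply/eqP; apply: contraTT D => nz; apply/negP => /dvdp_leq - /(_ nz).
    rewrite leqNgt; move: (sz [ffun i => c1 i - c2 i]).
    by under eq_bigr do rewrite ffunE scalerBl; move=> ->.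
  move/polyP/(_ i): Z; rewrite coef0 coef_sum (bigD1 i) //= big1 => [|j ji].
    by rewrite addr0 coefB !coefZ coefXn eqxx !mulr1 => /eqP; rewrite subr_eq0 => /eqP.
  by rewrite coefB !coefZ coefXn eq_sym (inj_eq val_inj) (negPf ji) !mulr0 subrr.
have U : uniq [seq ev c | c : {ffun 'I_e -> F}].
  by rewrite map_inj_uniq ?enum_uniq.
have S : {subset [seq ev c | c : {ffun (ordinal e) -> F}] <= Fixed e}.
  by move=> _ /mapP[c _ ->]; rewrite mem_Fixed // /ev Frob_horner He.
have [|_ H] := uniq_min_size U S.
  by rewrite size_Fixed // size_map -cardT card_ffun card_ord.
have := H w; rewrite mem_Fixed // Hw eqxx => /mapP[c _ ->].
by exists (\sum_(i < e) c i *: 'X^i).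
Qed.

End MinPoly.

(** A nonconstant divisor of [p] vanishes at some conjugate of [x], hence at [x] itself, since its
    coefficients lie in [F]. *)
Lemma minp_irr x e p : is_minpoly x e p -> irreducible_poly p.
Proof.
move=> Hp; have [e0 He Hm E] := Hp.
have p0 : p != 0 by apply: monic_neq0 (minp_monic Hp).
split; first by rewrite (minp_size Hp) ltnS.
move=> g g1 gp; rewrite /eqp gp /= (minp_dvd Hp).
have g0 : g != 0 by apply: contraNneq p0 => g0; move: gp; rewrite g0 dvd0p.
have /closed_rootP[y ry] : size (g^io) != 1%N by rewrite size_map_poly.
have : root (p^io) y by move: gp; rewrite -(dvdp_map iota) => /dvdpP[r ->]; rewrite rootM ry orbT.
rewrite E conj_polyE root_prod_XsubC => /mapP[i _ Ey].
rewrite /root -(inj_eq (@Frob_inj i)) Frob_horner -Ey rmorph0; exact: ry.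
Qed.

Lemma irr_factor (m : {poly F}) : (1 < size m)%N ->
  exists p, [/\ p \is monic, irreducible_poly p & p %| m].
Proof.
move=> sm; have m0 : m != 0 by rewrite -size_poly_gt0 ltnW.
have /closed_rootP[y ry] : size (m^io) != 1%N by rewrite size_map_poly; case: (size m) sm => [|[]].
have [e [p Hp]] := minpoly_ex m0 ry.
exists p; split; [exact: minp_monic Hp | exact: minp_irr Hp | by rewrite (minp_dvd Hp)].
Qed.

(** * The quadratic symbol as a resultant *)

Hypothesis odd_char : 2%N \notin [pchar F].

Definition half_card := (q.-1)./2.

Lemma card_odd : odd q.
Proof.
have [p [n [pK p_pr n0 ->]]] := card_pchar.
rewrite oddX; apply/orP; right; apply: contraR odd_char => ev.
have /eqP <- : p == 2%N by case/even_prime: p_pr ev => [->|->].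
by rewrite -(fmorph_pchar iota).
Qed.

Lemma card_exp_odd k : odd (q ^ k)%N.
Proof. by rewrite oddX card_odd orbT. Qed.

Lemma half_cardE : q = (half_card.*2).+1.
Proof.
rewrite /half_card; have := card_odd; have := card_gt1; case: (q) => // n _ /= on.
by rewrite -[in LHS](odd_double_half n) (negPf on).
Qed.

Lemma half_card_gt0 : (0 < half_card)%N.
Proof. by have := card_gt1; rewrite [X in (_ < X)%N -> _]half_cardE; case: half_card. Qed.

Lemma two_neq0 : 2%:R != 0 :> K.
Proof. by apply: contraNN odd_char => H; rewrite -(fmorph_pchar iota) inE /= H. Qed.

Lemma neq_opp1 : (-1 : K) != 1.
Proof. by apply: contraNN two_neq0 => /eqP H; rewrite -{1}H mulrS mulr1n -{1}H addNr. Qed.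

Definition quadchar (y : K) : int :=
  if y == 0 then 0 else if y ^+ half_card == 1 then 1 else -1.

Lemma quadcharE y : Frob 1 y = y -> (quadchar y)%:~R = y ^+ half_card :> K.
Proof.
rewrite /quadchar => Hy; have [->|y0] := eqVneq y 0; first by rewrite expr0n eqn0Ngt half_card_gt0.
have [->//|H] := eqVneq (y ^+ half_card) 1.
have : (y ^+ half_card) ^+ 2 == 1.
  rewrite -exprM muln2; apply/eqP; apply: (mulfI y0).
  by rewrite mulr1 -exprS -half_cardE -{2}Hy /Frob expn1.
by rewrite sqrf_eq1 (negPf H) /= => /eqP ->; rewrite rmorphN.
Qed.

(** Euler's criterion gives the identity in [K]; it lifts to the integers because 0, 1 and -1 stay
    distinct in odd characteristic. *)
Lemma quadcharM a b : Frob 1 a = a -> Frob 1 b = b -> quadchar (a * b) = quadchar a * quadchar b.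
Proof.
move=> Ha Hb.
have Hab : Frob 1 (a * b) = a * b by rewrite rmorphM /= Ha Hb.
have E : (quadchar (a * b))%:~R = (quadchar a * quadchar b)%:~R :> K.
  by rewrite rmorphM /= !quadcharE // exprMn.
move: E; rewrite /quadchar mulf_eq0; case: eqP => _ /=; first by rewrite mul0r.
case: eqP => _ /=; first by rewrite mulr0.
have N1 := neq_opp1.
by do 3 case: eqP => _ //=; rewrite ?mulrNN ?mulr1 ?mul1r ?rmorphN ?rmorph1 //= => /eqP; rewrite ?(negPf N1) // eq_sym (negPf N1).
Qed.

Lemma quadchar1 : quadchar 1 = 1. Proof. by rewrite /quadchar oner_eq0 expr1n eqxx. Qed.

Lemma quadchar_abs y : `|quadchar y| <= 1.
Proof. by rewrite /quadchar; case: eqP => _ //; case: eqP. Qed.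

Definition Fnorm k (y : K) := \prod_(i < k) Frob i y.

Lemma Fnorm_fixed k y : Frob k y = y -> Frob 1 (Fnorm k y) = Fnorm k y.
Proof.
case: k => [|k] Hy; first by rewrite /Fnorm big_ord0 rmorph1.
rewrite /Fnorm rmorph_prod /= [RHS]big_ord_recl [LHS]big_ord_recr /= mulrC -Frob_add add1n Hy Frob0.
by congr (_ * _); apply: eq_bigr => i _; rewrite -Frob_add.
Qed.

(** (1 + q + ... + q^(k-1)) (q-1)/2 = (q^k - 1)/2: composed with the norm, the quadratic character
    of [F] becomes that of the field with q^k elements. *)
Lemma Fnorm_exp k y : Fnorm k y ^+ half_card = y ^+ ((q ^ k).-1./2)%N.
Proof.
rewrite /Fnorm /Frob prodrXr -exprM; congr (_ ^+ _).
by rewrite predn_exp -[(q.-1)](congr1 predn (esym half_cardE)) /= -doubleMl doubleK mulnC.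
Qed.

Lemma Fnorm_eq0 k y : (0 < k)%N -> (Fnorm k y == 0) = (y == 0).
Proof.
move=> k0; apply/prodf_eq0/eqP => [[i _]|->]; first by rewrite expf_eq0 => /andP[_ /eqP].
by exists (Ordinal k0) => //; rewrite rmorph0.
Qed.

Lemma quadchar_Fnorm k y : (0 < k)%N -> Frob k y = y ->
  (quadchar (Fnorm k y))%:~R = y ^+ ((q ^ k).-1./2)%N :> K.
Proof. by move=> k0 Hy; rewrite quadcharE ?Fnorm_fixed // Fnorm_exp. Qed.

Variable d : {poly F}.

Definition Kroots (m : {poly F}) := sval (closed_field_poly_normal (m^io)).
Lemma KrootsE m : m \is monic -> m^io = \prod_(z <- Kroots m) ('X - z%:P).
Proof.
rewrite /Kroots; case: closed_field_poly_normal => s /= E mm.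
by rewrite {1}E (monicP _) ?scale1r // map_monic.
Qed.

(* Up to a sign and a power of the leading coefficient of d, the resultant of m
   and d. *)
Definition resd (m : {poly F}) := \prod_(z <- Kroots m) (d^io).[z].

Lemma resd_list m s : m^io = \prod_(z <- s) ('X - z%:P) -> resd m = \prod_(z <- s) (d^io).[z].
Proof.
move=> E; apply: perm_big; apply: prod_XsubC_eq; rewrite -E KrootsE //.
by rewrite -(map_monic iota) E monic_prod_XsubC.
Qed.

Lemma resdM m n : m \is monic -> n \is monic -> resd (m * n) = resd m * resd n.
Proof.
move=> mm mn; rewrite /resd -big_cat; apply: resd_list.
by rewrite rmorphM /= big_cat -!KrootsE.
Qed.

Lemma resd1 : resd 1 = 1.
Proof. by rewrite (@resd_list 1 [::]) ?big_nil // rmorph1. Qed.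

Lemma resd_fixed m : m \is monic -> Frob 1 (resd m) = resd m.
Proof.
move=> mm; rewrite /resd rmorph_prod /=.
have -> : \prod_(z <- Kroots m) (d^io).[z] = \prod_(z <- [seq Frob 1 z | z <- Kroots m]) (d^io).[z].
  apply: resd_list; rewrite big_map; under eq_bigr => z _.
    rewrite -[X in _ - X](map_polyC (Frob 1)) -{1}(map_polyX (Frob 1)) -rmorphB; over.
  rewrite -rmorph_prod /= -KrootsE // -map_poly_comp.
  by apply: eq_map_poly => a /=; rewrite Frob_iota.
by rewrite big_map; apply: eq_bigr => z _; rewrite Frob_horner.
Qed.

Lemma resd_conj_poly m k x : m^io = conj_poly k x -> resd m = Fnorm k (d^io).[x].
Proof.
rewrite conj_polyE => /resd_list ->; rewrite big_map -[seq.iota 0 k](congr1 (seq.iota 0) (subn0 k)) big_mkord.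
by apply: eq_bigr => i _; rewrite Frob_horner.
Qed.

Definition symb (m : {poly F}) : int := quadchar (resd m).

Lemma symbM m n : m \is monic -> n \is monic -> symb (m * n) = symb m * symb n.
Proof. by move=> mm mn; rewrite /symb resdM // quadcharM ?resd_fixed. Qed.

Lemma symb1 : symb 1 = 1. Proof. by rewrite /symb resd1 quadchar1. Qed.

(** For a root x of [p] of degree e, the symbol is the quadratic character of d(x) in the field with
    q^e elements. A square root w of d(x) exists in [K]; Euler's criterion places it in that field,
    and there it is the value at x of a polynomial over [F]. *)
Lemma symb_irreducible p : p \is monic -> irreducible_poly p ->
  [/\ p %| d -> symb p = 0, ~~ (p %| d) -> symb p != 0 &
   ~~ (p %| d) -> (exists y : {poly F}, p %| y ^+ 2 - d) <-> symb p = 1].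
Proof.
move=> mp ip; have p0 := monic_neq0 mp.
have /closed_rootP[x rx] : size (p^io) != 1%N.
  by rewrite size_map_poly; case: ip => + _; case: (size p) => [|[]].
have [e [p' Hp']] := minpoly_ex p0 rx.
have Hp : is_minpoly x e p by rewrite (minp_eq Hp' mp ip rx).
have [e0 He Hm E] := Hp.
have Fd : Frob e (d^io).[x] = (d^io).[x] by rewrite Frob_horner He.
have RE : resd p = Fnorm e (d^io).[x] := resd_conj_poly E.
have z : (symb p == 0) = (p %| d).
  rewrite (minp_dvd Hp) /symb RE /quadchar Fnorm_eq0 // /root.
  by case: (_.[x] == 0) => //; case: (_ == 1).
split=> [pd|pd|pd]; first by apply/eqP; rewrite z.
  by rewrite z.
have dx0 : (d^io).[x] != 0 by rewrite (minp_dvd Hp) in pd.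
have R1 : symb p = 1 <-> (d^io).[x] ^+ ((q ^ e).-1./2)%N = 1.
  rewrite /symb RE /quadchar Fnorm_eq0 // (negPf dx0) Fnorm_exp; split; last by move=> ->; rewrite eqxx.
  by case: eqP.
have qo := card_exp_odd e; have q0 : (0 < q ^ e)%N by rewrite expn_gt0 (ltnW card_gt1).
have q2 : (q ^ e).-1 = ((q ^ e).-1./2).*2.
  by move: qo q0; case: (q ^ e)%N => // n /= on _; rewrite -[LHS]odd_double_half (negPf on).
split=> [[y dy]|/R1 H1].
  apply/R1; move: dy.
  rewrite (minp_dvd Hp) rmorphB rmorphXn /= /root !hornerE subr_eq0 => /eqP Ey.
  have Fy : Frob e (y^io).[x] = (y^io).[x] by rewrite Frob_horner He.
  have y0 : (y^io).[x] != 0.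
    by apply: contraNneq dx0 => y0; rewrite -Ey y0 expr0n.
  rewrite -Ey -exprM mul2n -q2; apply: (mulfI y0).
  by rewrite -exprS prednK // mulr1.
have /closed_rootP[w] : size ('X^2 - ((d^io).[x])%:P) != 1%N.
  by rewrite size_XnsubC.
rewrite /root !hornerE subr_eq0 => /eqP Hw.
have Fw : Frob e w = w.
  by rewrite /Frob -(prednK q0) exprS q2 -muln2 mulnC exprM Hw H1 mulr1.
have [y Ey] := minp_eval_surj Hp Fw.
exists y; rewrite (minp_dvd Hp) rmorphB rmorphXn /= /root !hornerE -Ey Hw subrr //.
Qed.

(** * Coefficients of L and character sums *)

Definition monics n : seq {poly F} := [seq monic_of c | c : {ffun 'I_n -> F}].

Lemma coef_monic_of n (c : {ffun 'I_n -> F}) (i : 'I_n) : (monic_of c)`_i = c i.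
Proof.
rewrite /monic_of coefD coefXn ltn_eqF ?ltn_ord // add0r coef_sum (bigD1 i) //= big1 => [|j ji].
  by rewrite addr0 coefZ coefXn eqxx mulr1.
by rewrite coefZ coefXn eq_sym (inj_eq val_inj) (negPf ji) mulr0.
Qed.

Lemma size_monic_tail n (c : {ffun 'I_n -> F}) : (size (\sum_(i < n) c i *: 'X^i)%R <= n)%N.
Proof.
apply: leq_trans (size_sum _ _ _) _; apply/bigmax_leqP => i _.
by apply: leq_trans (size_scale_leq _ _) _; rewrite size_polyXn.
Qed.

Lemma size_monic_of n (c : {ffun 'I_n -> F}) : size (monic_of c) = n.+1.
Proof. by rewrite /monic_of size_polyDl size_polyXn ?ltnS ?size_monic_tail. Qed.

Lemma monic_ofP n (c : {ffun 'I_n -> F}) : monic_of c \is monic.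
Proof.
by rewrite monicE /monic_of lead_coefDl ?lead_coefXn // size_polyXn ltnS size_monic_tail.
Qed.

Lemma uniq_monics n : uniq (monics n).
Proof.
rewrite map_inj_uniq ?enum_uniq // => c1 c2 E; apply/ffunP => i.
by rewrite -!coef_monic_of E.
Qed.

Lemma mem_monics n m : (m \in monics n) = (m \is monic) && (size m == n.+1).
Proof.
apply/mapP/andP => [[c _ ->]|[mm /eqP sm]]; first by rewrite size_monic_of monic_ofP.
exists [ffun i : 'I_n => m`_i]; first by rewrite mem_enum.
apply/polyP => i; have [ni|ni] := ltnP i n.
  by rewrite -[i in RHS]/(val (Ordinal ni)) coef_monic_of ffunE.
move: ni; rewrite leq_eqVlt => /predU1P[<-|ni].
  move/monicP: mm; have /monicP := monic_ofP [ffun i : 'I_n => m`_i].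
  by rewrite /lead_coef size_monic_of sm /= => -> ->.
by rewrite !nth_default ?size_monic_of ?sm.
Qed.

Definition Lcoef n : int := \sum_(m <- monics n) symb m.
Definition charsum k : int := \sum_(x <- Fixed k) quadchar (Fnorm k (d^io).[x]).

Lemma Lcoef0 : Lcoef 0 = 1.
Proof.
have P : perm_eq (monics 0) [:: 1].
  apply: uniq_perm => // [|m]; first exact: uniq_monics.
  rewrite mem_monics inE; apply/andP/eqP => [[mm /size_poly1P[c _ E]]|->].
    by move: mm; rewrite E monicE lead_coefC => /eqP ->.
  by rewrite monic1 size_poly1.
by rewrite /Lcoef (perm_big _ P) big_seq1 symb1.
Qed.

Lemma size_Kroots m n : m \in monics n -> size (Kroots m) = n.
Proof.
rewrite mem_monics => /andP[mm /eqP sm]; apply: succn_inj.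
by rewrite -(size_prod_XsubC _ id) -KrootsE // size_map_poly.
Qed.

(** [conj_poly k x] comes from a monic h over [F] of degree k. Multiplication by h is a bijection
    from the monic polynomials of degree n - k to the multiples of h of degree n, and it scales the
    symbol by that of h. *)
Lemma Lcoef_dvd n k x : (k <= n)%N -> Frob k x = x ->
  quadchar (Fnorm k (d^io).[x]) * Lcoef (n - k) = \sum_(m <- monics n | conj_poly k x %| m^io) symb m.
Proof.
move=> kn Hx; have [h Hh] := conj_poly_fixed Hx.
have mh : h \is monic by rewrite -(map_monic iota) -Hh conj_poly_monic.
have sh : size h = k.+1 by rewrite -(size_map_poly iota) -Hh size_conj_poly.
rewrite -(resd_conj_poly (esym Hh)) -/(symb h) /Lcoef big_distrr /= -[RHS]big_filter.
have P : perm_eq [seq m <- monics n | conj_poly k x %| m^io] [seq h * m | m <- monics (n - k)].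
  apply: uniq_perm; first by rewrite filter_uniq ?uniq_monics.
    by rewrite map_inj_uniq ?uniq_monics //; apply: mulfI; apply: monic_neq0.
  move=> m; rewrite mem_filter mem_monics Hh dvdp_map.
  apply/andP/mapP => [[/dvdpP[m' E] /andP[mm /eqP sm]]|[m']].
    have mm' : m' \is monic by move: mm; rewrite E mulrC monicMl.
    exists m'; last by rewrite E mulrC.
    rewrite mem_monics mm' /=; move: sm; rewrite E size_mul ?monic_neq0 // sh addnS /=.
    by move=> E'; rewrite -subSn // -E' addnK.
  rewrite mem_monics => /andP[mm' /eqP sm'] ->.
  rewrite dvdp_mulr // monicMl // mm' size_mul ?monic_neq0 // sh sm'.
  by rewrite addSn /= addnS subnKC.
rewrite [RHS](perm_big _ P) [RHS]big_map big_seq [RHS]big_seq; apply: eq_bigr => m.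
by rewrite mem_monics => /andP[mm _]; rewrite symbM.
Qed.

Lemma count_dvd_bounded e mu n : (0 < e)%N -> (mu * e <= n)%N ->
  (\sum_(1 <= k < n.+1) ((e %| k) && (k %/ e <= mu)) = mu)%N.
Proof.
move=> e0 len; rewrite (@big_cat_nat _ _ _ (mu * e).+1) //=.
rewrite [X in (_ + X)%N]big_nat [X in (_ + X)%N]big1 => [|k /andP[k1 _]]; last first.
  by case: dvdnP => //= -[j Ej]; move: k1; rewrite Ej mulnK // ltn_pmul2r // ltnNge => /negPf ->.
rewrite addn0 -[RHS](mulnK mu e0) divn_count_dvd !big_nat; apply: eq_bigr => k /andP[_ k1].
by case: dvdnP => //= -[j Ej]; move: k1; rewrite Ej mulnK // ltnS leq_pmul2r // => ->.
Qed.

Lemma count_conj_poly n m : m \in monics n ->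
  (\sum_(1 <= k < n.+1) count (fun x => conj_poly k x %| m^io)%R (Fixed k) = n)%N.
Proof.
move=> mn; have := mn; rewrite mem_monics => /andP[mm /eqP sm].
have m0 := monic_neq0 mm.
have mE := KrootsE mm.
transitivity (\sum_(1 <= k < n.+1) \sum_(x <- undup (Kroots m)) ((Frob k x == x) && (conj_poly k x %| m^io)%R))%N.
  rewrite !big_nat; apply: eq_bigr => k /andP[k0 _].
  rewrite -(big_mkcond (fun x => (Frob k x == x) && (conj_poly k x %| m^io)) (fun=> 1%N)) /= sum1_count -!size_filter.
  apply: perm_size; apply: uniq_perm; rewrite ?filter_uniq ?undup_uniq ?Fixed_uniq // => x.
  rewrite !mem_filter mem_Fixed // mem_undup -root_prod_XsubC -mE.
  case gm: (conj_poly k x %| m^io); rewrite ?andbF //= andbT.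
  suff -> : root (m^io) x by rewrite andbT.
  move: gm; move/dvdpP => [r ->]; rewrite rootM conj_polyE root_prod_XsubC; apply/orP; right.
  by apply/mapP; exists 0%N; rewrite ?mem_iota ?Frob0.
rewrite exchange_big /= -[RHS](size_Kroots mn).
transitivity (\sum_(x <- undup (Kroots m)) count_mem x (Kroots m))%N; last first.
  rewrite -sum1_size -[RHS]big_undup_iterop_count; apply: eq_bigr => x _.
  by rewrite Monoid.iteropE iter_addn_0 mul1n.
rewrite !big_seq; apply: eq_bigr => x; rewrite mem_undup => xr.
have rx : root (m^io) x by rewrite mE root_prod_XsubC.
have [e [p Hp]] := minpoly_ex m0 rx.
have [e0 He Hm _] := Hp.
(* This keeps all the indices e, 2e, ..., mult(x) e inside the range of summation. *)
have mup_le : (mup x (m^io) * e <= n)%N.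
  have : p ^+ mup x (m^io) %| m by rewrite (minp_exp_dvd Hp).
  move/dvdp_leq => /(_ m0); rewrite sm => H; rewrite -ltnS; apply: leq_trans H.
  have := size_exp p (mup x (m^io)); rewrite (minp_size Hp) /= mulnC => <-.
  by rewrite prednK // size_poly_gt0 expf_neq0 // monic_neq0 // (minp_monic Hp).
rewrite -mu_prod_XsubC -mE -[RHS](count_dvd_bounded e0 mup_le); apply: eq_bigr => k _.
have -> : (Frob k x == x) = (e %| k)%N.
  by apply/eqP/idP => [/Hm //|/dvdnP[j ->]]; apply: Frob_mul.
by case ek: (e %| k)%N => //=; rewrite (minp_conj_poly_dvd Hp) //; case/dvdnP: ek => j ->; apply: Frob_mul.
Qed.

(* Every m of degree n is divisible by conj_poly k x for exactly n pairs (k, x):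
   for a root x of degree e these are k = e, 2e, ..., mult(x) e. *)
Lemma Lcoef_rec n : n%:Z * Lcoef n = \sum_(1 <= k < n.+1) charsum k * Lcoef (n - k).
Proof.
transitivity (\sum_(1 <= k < n.+1) \sum_(x <- Fixed k) \sum_(m <- monics n | conj_poly k x %| m^io) symb m).
  under eq_bigr do under eq_bigr do rewrite big_mkcond.
  under eq_bigr do rewrite exchange_big.
  rewrite exchange_big /= /Lcoef big_distrr /= !big_seq; apply: eq_bigr => m mn.
  rewrite -{1}(count_conj_poly mn) -natz natr_sum mulr_suml; apply: eq_bigr => k _.
  by rewrite -big_mkcond /= big_const_seq iter_addr_0 mulr_natl.
rewrite !big_nat; apply: eq_bigr => k /andP[k1 kn].
rewrite /charsum mulr_suml !big_seq; apply: eq_bigr => x.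
by rewrite mem_Fixed // => /eqP Hx; rewrite -Lcoef_dvd.
Qed.

Lemma charsum_le k : (0 < k)%N -> `|charsum k| <= (q ^ k)%:Z.
Proof.
move=> k0; apply: le_trans (ler_norm_sum _ _ _) _.
apply: (@le_trans _ _ (\sum_(x <- Fixed k) 1)); first by apply: ler_sum => x _; apply: quadchar_abs.
by rewrite big_const_seq count_predT iter_addr_0 size_Fixed // natz.
Qed.

(** * Vanishing of the coefficients from degree D on *)

Hypothesis d0 : d != 0.
Hypothesis sqf : forall p : {poly F}, (1 < size p)%N -> ~~ (p * p %| d).
Hypothesis d_size : (1 < size d)%N.

(** Square-freeness is used through one simple root: its odd multiplicity shows that d is not a
    square up to constants, and the coprime splitting feeds the Chinese remainder argument. *)
Lemma d_factor : exists x e p d1,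
  [/\ is_minpoly x e p, d = p * d1, coprimep p d1 & mup x (d^io) = 1%N].
Proof.
have [p' [mp ip pd]] := irr_factor d_size.
have /closed_rootP[x rx] : size (p'^io) != 1%N.
  by rewrite size_map_poly; case: ip => + _; case: (size p') => [|[]].
have [e [p Hp]] := minpoly_ex (monic_neq0 mp) rx.
move: pd; rewrite (minp_eq Hp mp ip rx) => /dvdpP[d1 E].
have d1x : ~~ root (d1^io) x.
  rewrite -(minp_dvd Hp); apply/negP => /dvdpP[r E2].
  have /sqf/negP[] : (1 < size p)%N by rewrite (minp_size Hp) ltnS; case: Hp.
  by rewrite E E2 -mulrA dvdp_mull.
exists x, e, p, d1; split=> //; first by rewrite mulrC.
  apply/coprimepP => g gp gd; have [_ ip'] := minp_irr Hp.
  rewrite -size_poly_eq1; apply: contraTT d1x => g1; rewrite negbK -(minp_dvd Hp).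
  by have := ip' g g1 gp; rewrite /eqp => /andP[_ pg]; apply: dvdp_trans gd.
by rewrite E rmorphM mupMr // (minp_mup Hp).
Qed.

Lemma Kroots_spec (m : {poly F}) : m^io = lead_coef (m^io) *: \prod_(z <- Kroots m) ('X - z%:P).
Proof. by rewrite /Kroots; case: closed_field_poly_normal. Qed.

(** The resultant with the roles exchanged; as a product over the roots of [d] it depends only on
    [u] mod [d]. *)
Definition evald (u : {poly F}) := \prod_(y <- Kroots d) (u^io).[y].

Lemma root_Kroots y : y \in Kroots d -> (d^io).[y] = 0.
Proof.
by move=> yd; rewrite Kroots_spec hornerZ (rootP _) ?mulr0 // root_prod_XsubC.
Qed.

(** Reciprocity of the resultant. The extra factor depends on [n] alone, so symbols of monic
    polynomials of equal degree are compared through [evald]. *)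
Lemma resd_evald m n : m \in monics n ->
  resd m = lead_coef (d^io) ^+ n * (-1) ^+ (n * size (Kroots d)) * evald m.
Proof.
move=> mn; have := mn; rewrite mem_monics => /andP[mm _].
have -> : resd m = \prod_(z <- Kroots m) (lead_coef (d^io) * (-1) ^+ size (Kroots d) * \prod_(y <- Kroots d) (y - z)).
  apply: eq_bigr => z _; rewrite {1}Kroots_spec hornerZ -mulrA; congr (_ * _).
  rewrite horner_prod; elim: (Kroots d) => [|y s IH]; first by rewrite !big_nil mulr1.
  by rewrite !big_cons hornerXsubC IH /= exprS; ring.
rewrite big_split /= big_const_seq count_predT iter_mulr_1 (size_Kroots mn).
rewrite exprMn -exprM mulnC; congr (_ * _).
rewrite exchange_big /=; apply: eq_bigr => y _.
by rewrite (KrootsE mm) horner_prod; apply: eq_bigr => z _; rewrite !hornerE.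
Qed.

(** With h = (q^e - 1)/2, the polynomial X (X^h - 1) has degree h + 1 < 2h + 1 = q^e, so it cannot
    vanish on the whole field. *)
Lemma nonsquare_ex e : (0 < e)%N -> exists w, [/\ Frob e w = w, w != 0 & quadchar (Fnorm e w) = -1].
Proof.
move=> e0.
have qo := card_exp_odd e; have q0 : (0 < q ^ e)%N by rewrite expn_gt0 (ltnW card_gt1).
have q1 : (1 < q ^ e)%N by rewrite -(exp1n e) ltn_exp2r // card_gt1.
have q2 : (q ^ e).-1 = ((q ^ e).-1./2).*2.
  by move: qo q0; case: (q ^ e)%N => // n /= on _; rewrite -[LHS]odd_double_half (negPf on).
set h := ((q ^ e).-1./2)%N in q2.
have h0 : (0 < h)%N by move: q1; rewrite -(prednK q0) q2; case: (h).
have /hasP[w] : has (fun w => (w != 0) && (w ^+ h != 1)) (Fixed e).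
  apply/negPn/negP => /hasPn H.
  have := @max_poly_roots _ ('X * ('X^h - 1)) (Fixed e) _ _ (Fixed_uniq e0).
  have X1 : 'X^h - 1 != 0 :> {poly K} by rewrite -size_poly_eq0 size_XnsubC.
  rewrite size_Fixed // mulrC size_mulX // size_XnsubC // => K1.
  have // : (q ^ e < h.+2)%N.
    apply: K1; first by rewrite mulf_neq0 // polyX_eq0.
    apply/allP => w /H; rewrite negb_and !negbK rootM /root !hornerE subr_eq0 orbC.
    by [].
  by rewrite -(prednK q0) q2 -addnn; move: h0; lia.
rewrite mem_Fixed // => /eqP Hw /andP[w0 w1]; exists w; split=> //.
by rewrite /quadchar Fnorm_eq0 // (negPf w0) Fnorm_exp (negPf w1).
Qed.

(* By the Chinese remainder theorem: a norm that is a nonsquare modulo one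
   irreducible factor of d, and 1 modulo the others. *)
Lemma twist_ex : exists u, [/\ coprimep d u, Frob 1 (evald u) = evald u & quadchar (evald u) = -1].
Proof.
have [x [e [p [d1 [Hp dE cop _]]]]] := d_factor.
have [e0 He Hm E] := Hp.
have [w [Hw w0 qw]] := nonsquare_ex e0.
have [v Ev] := minp_eval_surj Hp Hw.
have /Bezout_eq1_coprimepP[[a b] /= ab] := cop.
pose u := v * (b * d1) + a * p.
have ab' : b * d1 = 1 - a * p by rewrite -ab addrAC subrr add0r.
have up y : root (p^io) y -> (u^io).[y] = (v^io).[y].
  move=> /rootP ry; rewrite /u ab' !(rmorphD, rmorphN, rmorphM, rmorph1) /= !hornerE ry; ring.
have ud y : root (d1^io) y -> (u^io).[y] = 1.
  move=> /rootP ry; have -> : u = 1 + (v - 1) * (b * d1) by rewrite /u (_ : a * p = 1 - b * d1) ?(canRL (addrK _) ab) //; ring.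
  by rewrite !(rmorphD, rmorphN, rmorphM, rmorph1) /= !hornerE ry [X in _ + X]mulr0 addr0.
have perm : perm_eq (Kroots d) ([seq Frob i x | i <- seq.iota 0 e] ++ Kroots d1).
  apply: prod_XsubC_eq; rewrite big_cat /= -conj_polyE -E.
  have l0 : lead_coef (d^io) != 0 by rewrite lead_coef_eq0 map_poly_eq0.
  apply: (scalerI l0); rewrite -Kroots_spec {1}dE rmorphM /= {1}(Kroots_spec d1) -scalerAr; congr (_ *: _).
  have /monicP lp : p^io \is monic by rewrite map_monic (minp_monic Hp).
  by rewrite dE rmorphM lead_coefM /= lp mul1r.
have evaldE : evald u = Fnorm e w.
  rewrite /evald (perm_big _ perm) /= big_cat /= [X in _ * X]big_seq [X in _ * X]big1 ?mulr1; last first.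
    move=> y yr; apply: ud; rewrite Kroots_spec rootE hornerZ (rootP _) ?mulr0 // root_prod_XsubC //.
  rewrite big_map -[seq.iota 0 e](congr1 (seq.iota 0) (subn0 e)) big_mkord.
  by apply: eq_bigr => i _; rewrite up ?(minp_root Hp) // -Frob_horner -Ev.
exists u; rewrite evaldE Fnorm_fixed //; split=> //.
rewrite -(coprimep_map iota); apply/coprimepP => g gd gu.
rewrite -size_poly_eq1; apply: contraT => /closed_rootP[y ry].
have : y \in Kroots d.
  rewrite -root_prod_XsubC; move: gd; rewrite Kroots_spec dvdpZr ?lead_coef_eq0 ?map_poly_eq0 //.
  by move=> /dvdpP[r ->]; rewrite rootM ry orbT.
move=> yd; have : evald u == 0.
  apply/eqP; rewrite /evald (big_rem y) //= (rootP _) ?mul0r //.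
  by move: gu => /dvdpP[r ->]; rewrite rootM ry orbT.
by rewrite evaldE Fnorm_eq0 // (negPf w0).
Qed.

(* Replacing the residue of m mod d by that of u m permutes the monic
   polynomials of degree n >= deg d and flips the sign of the symbol. *)
Lemma Lcoef_vanish n : ((size d).-1 <= n)%N -> Lcoef n = 0.
Proof.
move=> dn; have [u [cu fu qu]] := twist_ex.
have sdn : (size d <= n.+1)%N by rewrite -ltnS in dn; case: (size d) dn.
pose T (m : {poly F}) := m + ((u * m) %% d - m %% d).
have szT m : (size ((u * m) %% d - m %% d)%R < size d)%N.
  apply: leq_ltn_trans (size_polyD _ _) _; rewrite size_polyN gtn_max !ltn_modp d0 //.
have T_mon m : m \in monics n -> T m \in monics n.
  rewrite !mem_monics => /andP[mm /eqP sm].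
  have lt : (size ((u * m) %% d - m %% d)%R < size m)%N.
    by rewrite sm; apply: leq_trans (szT m) _.
  by rewrite /T monicE lead_coefDl // size_polyDl // sm eqxx andbT -monicE.
have T_mod m : T m %% d = (u * m) %% d.
  by rewrite /T !modpD modpN !modp_id addrC subrK.
have T_inj : {in monics n &, injective T}.
  move=> m1 m2 _ _ E; have E2 : (u * m1) %% d = (u * m2) %% d by rewrite -!T_mod E.
  have : d %| u * (m1 - m2) by rewrite mulrBr /dvdp modpD modpN E2 subrr.
  rewrite Gauss_dvdpr // /dvdp modpD modpN subr_eq0 => /eqP E3.
  by move: E; rewrite /T E2 E3 => /addIr.
have P : perm_eq [seq T m | m <- monics n] (monics n).
  have U : uniq [seq T m | m <- monics n] by rewrite map_inj_in_uniq ?uniq_monics.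
  apply: uniq_perm => //; first exact: uniq_monics.
  have S : {subset [seq T m | m <- monics n] <= monics n}.
    by move=> _ /mapP[m mn ->]; apply: T_mon.
  have sz : (size (monics n) <= size [seq T m | m <- monics n])%N by rewrite size_map.
  by have [_ H] := uniq_min_size U S sz.
have rT m : m \in monics n -> symb (T m) = - symb m.
  move=> mn; have Tn := T_mon m mn.
  have mm : m \is monic by move: mn; rewrite mem_monics => /andP[].
  rewrite /symb (resd_evald Tn).
  have -> : evald (T m) = evald u * evald m.
    rewrite /evald -big_split /= !big_seq; apply: eq_bigr => y yd.
    rewrite (divp_eq (T m) d) T_mod -hornerM -rmorphM.
    rewrite {2}(divp_eq (u * m) d) !(rmorphD, rmorphM) /= !hornerE root_Kroots //.
    by rewrite !mulr0.
  rewrite mulrCA -(resd_evald mn) quadcharM ?resd_fixed // qu mulN1r //.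
have : Lcoef n = - Lcoef n.
  rewrite {1}/Lcoef -(perm_big _ P) /= [LHS]big_map big_seq /Lcoef -sumrN [RHS]big_seq.
  by apply: eq_bigr => m /rT.
by lia.
Qed.

(** * Stepanov's method *)

(** Pigeonhole over the finite field: there are more coefficient vectors than polynomials of size at
    most n, and two vectors with the same image are subtracted. *)
Lemma kernel_ex (I : finType) n (f : I -> {poly F}) :
  (n < #|I|)%N -> (forall i, size (f i) <= n)%N ->
  exists c : I -> F, (exists i, c i != 0) /\ \sum_i c i *: f i = 0.
Proof.
move=> nI sf.
pose ev (c : {ffun I -> F}) : {ffun 'I_n -> F} := [ffun s : 'I_n => (\sum_i c i *: f i)`_s].
have /injectivePn[c1 [c2 c12 E]] : ~~ injectiveb ev.
  apply/negP => /injectiveP /leq_card; rewrite !card_ffun card_ord leqNgt.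
  by rewrite ltn_exp2l ?card_gt1 // nI.
exists (fun i => c1 i - c2 i); split.
  apply/existsP; apply: contraNT c12; rewrite negb_exists => /forallP H.
  by apply/eqP/ffunP => i; apply/eqP; rewrite -subr_eq0; have := H i; rewrite negbK.
apply/polyP => s; rewrite coef0; have [sn|sn] := ltnP s n.
  move/ffunP/(_ (Ordinal sn)): E; rewrite !ffunE /= => E.
  under eq_bigr do rewrite scalerBl.
  by rewrite sumrB coefB E subrr.
rewrite nth_default //; apply: leq_trans sn; apply: leq_trans (size_sum _ _ _) _.
by apply/bigmax_leqP => i _; apply: leq_trans (size_scale_leq _ _) _.
Qed.

(** [G] is read as a polynomial in a second variable Z with coefficients in F[X]; the bound is on
    the degree in X. *)
Definition coef_size_le n (G : {poly {poly F}}) := forall i, (size (G`_i)%R <= n)%N.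

Lemma coef_size_le_mul m n A B : coef_size_le m.+1 A -> coef_size_le n.+1 B -> coef_size_le (m + n).+1 (A * B).
Proof.
move=> HA HB i; rewrite coefM; apply: leq_trans (size_sum _ _ _) _.
apply/bigmax_leqP => j _; apply: leq_trans (size_polyMleq _ _) _.
by have := leq_add (HA j) (HB (i - j)%N); rewrite addSn addnS; case: (_ + _)%N.
Qed.

(** Coefficients of degree below P act as digits in base X^P, so the substitution Z = X^P loses
    nothing. *)
Lemma coef_size_le_horner_eq0 P G : coef_size_le P G -> G.['X^P] = 0 -> G = 0.
Proof.
elim/poly_ind: G => // G c IH H; rewrite !hornerE => E.
have sc : (size c <= P)%N.
  by have := H 0%N; rewrite coefD coefMX coefC add0r.
have HG : coef_size_le P G by move=> i; have := H i.+1; rewrite coefD coefMX coefC addr0.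
have GP : G.['X^P] = 0.
  apply: contraTeq sc => G0; rewrite -ltnNge.
  have -> : c = - (G.['X^P] * 'X^P) by apply/eqP; rewrite -addr_eq0 addrC E.
  by rewrite size_polyN size_mulXn // -[X in (X < _)%N]addn0 ltn_add2l size_poly_gt0.
have c0 : c = 0 by move: E; rewrite GP mul0r add0r.
by rewrite (IH HG GP) c0 mul0r add0r.
Qed.

Lemma coef_size_le_trans m n G : (m <= n)%N -> coef_size_le m G -> coef_size_le n G.
Proof. by move=> mn H i; apply: leq_trans mn. Qed.

Lemma coef_size_leB n A B : coef_size_le n A -> coef_size_le n B -> coef_size_le n (A - B).
Proof.
move=> HA HB i; rewrite coefB; apply: leq_trans (size_polyD _ _) _.
by rewrite size_polyN geq_max HA HB.
Qed.

(** At a simple root of [d] the two sides would have multiplicities of opposite parity. *)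
Lemma d_nonsquare (a b : {poly F}) c : c != 0 -> a ^+ 2 = d * c%:P * b ^+ 2 -> a = 0 /\ b = 0.
Proof.
move=> c0 E; have [x [_ [_ [_ [_ _ _ mx]]]]] := d_factor.
have cP : c%:P != 0 by rewrite polyC_eq0.
have [b0|b0] := eqVneq b 0.
  by move/eqP: E; rewrite b0 expr0n mulr0 expf_eq0 /= => /eqP ->.
have a0 : a != 0.
  by apply: contra_eq_neq E => ->; rewrite expr0n eq_sym !mulf_neq0 // expf_neq0.
have /(congr1 (fun g => mup x (g^io))) := E.
have mc : mup x ((c%:P)^io) = 0%N by rewrite map_polyC mupNroot // rootC fmorph_eq0.
rewrite !expr2 !rmorphM /= !mupM ?mulf_neq0 ?map_poly_eq0 // mx mc /=.
by lia.
Qed.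

Lemma pow_card_comp j (g : {poly F}) : g ^+ (q ^ j)%N = g \Po 'X^(q ^ j).
Proof.
have pn : [pchar {poly F}].-nat (q ^ j)%N.
  by rewrite (eq_pnat _ (pchar_poly F)) -(eq_pnat _ (fmorph_pchar iota)) card_exp_pnat.
elim/poly_ind: g => [|g c IH]; first by rewrite expr0n expn_eq0 (gtn_eqF (ltnW card_gt1)) comp_poly0.
rewrite exprDn_pchar // exprMn IH comp_polyD comp_polyM comp_polyX comp_polyC; congr (_ + _).
rewrite -polyC_exp; congr _%:P; apply: (fmorph_inj iota).
by rewrite rmorphXn -[LHS]/(Frob j (iota c)) Frob_iota.
Qed.

Local Notation D := (size d).-1.

Lemma half_odd_exp j : let P := (q ^ j)%N in P = (P./2).*2.+1.
Proof. by rewrite /= -[LHS]odd_double_half card_exp_odd. Qed.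

Section Stepanov.
Variables (j : nat) (eps : F).
Local Notation P := (q ^ j)%N.
Local Notation r := (P./2).
(** [l] and [M] bound the exponents s and i. [lP] keeps the X-degrees of a^2 and d b^2 below P,
    which makes A nonzero; [lM] says that the 2lM unknowns outnumber the linear conditions. *)
Variables (l M : nat).
Hypothesis lP : (l.*2 + D <= P)%N.
Hypothesis lM : (r.+1 * D + l * P + M < 2 * (l * M))%N.

Let I : finType := (bool * ('I_l * 'I_M))%type.
Let g (i : I) : {poly F} :=
  (eps *: d ^+ r.+1) ^+ i.1 * 'X^(i.2.1 * P + i.2.2).
Let h (i : I) : {poly F} := (d ^+ r.+1) ^+ i.1 * 'X^(i.2.1 + i.2.2 * P).

Lemma size_dpow (b : bool) : (size ((d ^+ r.+1) ^+ b)%R <= (r.+1 * D).+1)%N.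
Proof.
case: b; rewrite ?expr1 ?expr0 ?size_poly1 //.
by rewrite -[X in (X <= _)%N]prednK ?size_poly_gt0 ?expf_neq0 // size_exp mulnC.
Qed.

Lemma stepanov_coef : exists c : I -> F,
  (exists i, c i != 0) /\ \sum_i c i *: g i = 0.
Proof.
apply: (kernel_ex (n := (r.+1 * D + l * P + M)%N)).
  by rewrite !card_prod card_bool !card_ord.
move=> [b [s i]] /=; apply: leq_trans (size_polyMleq _ _) _.
have sb : (size ((eps *: d ^+ r.+1) ^+ b)%R <= (r.+1 * D).+1)%N.
  case: b; last exact: (size_dpow false).
  by apply: leq_trans (size_scale_leq _ _) (size_dpow true).
rewrite size_polyXn.
have sl : (s.+1 * P <= l * P)%N by rewrite leq_mul2r ltn_ord orbT.
have iM := ltn_ord i.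
rewrite addnS /= -addnA; move: sl; rewrite mulSn => sl.
have P0 : (0 < P)%N by rewrite expn_gt0 (ltnW card_gt1).
move: sb sl iM P0; move: P (nat_of_ord i) (s * P)%N (l * P)%N (r.+1 * D)%N (size _).
by clear; lia.
Qed.

Variable c : I -> F.
Hypothesis c_neq0 : exists i, c i != 0.
Hypothesis c_ker : \sum_i c i *: g i = 0.

Let A := \sum_i c i *: h i.

Lemma stepanov_size : (size A <= r.+1 * D + l + M * P)%N.
Proof.
apply: leq_trans (size_sum _ _ _) _; apply/bigmax_leqP => -[b [s i]] _.
apply: leq_trans (size_scale_leq _ _) _; rewrite /h /=.
apply: leq_trans (size_polyMleq _ _) _; have sb := size_dpow b.
rewrite size_polyXn addnS /=.
have iM : (i.+1 * P <= M * P)%N by rewrite leq_mul2r ltn_ord orbT.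
have sl := ltn_ord s; move: iM; rewrite mulSn => iM.
have P0 : (0 < P)%N by rewrite expn_gt0 (ltnW card_gt1).
move: sb iM sl P0; move: P (nat_of_ord s) (i * P)%N (M * P)%N (r.+1 * D)%N (size _).
by clear; lia.
Qed.

(** The cofactor of d^(b(P+1)/2) in A, with X^P replaced by the second variable Z. *)
Let ab (b : bool) : {poly {poly F}} := \sum_(si : 'I_l * 'I_M) (c (b, si) *: 'X^(si.1))%:P * 'X^(si.2).

Lemma coef_ab b (si : 'I_l * 'I_M) : (ab b)`_(si.2)`_(si.1) = c (b, si).
Proof.
rewrite /ab coef_sum coef_sum (bigD1 si) //= big1 => [|sj ji].
  by rewrite coefCM coefXn eqxx mulr1 coefZ coefXn eqxx mulr1 addr0.
rewrite coefCM coefXn; case: eqP => [E1|_]; last by rewrite mulr0 coef0.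
rewrite mulr1 coefZ coefXn; case: eqP => [E2|_]; last by rewrite mulr0.
by case/eqP: ji; case: (sj) (si) E1 E2 => ? ? [? ?] /= /val_inj -> /val_inj ->.
Qed.

Lemma coef_size_le_ab b : coef_size_le l (ab b).
Proof.
move=> i; rewrite /ab coef_sum; apply: leq_trans (size_sum _ _ _) _.
apply/bigmax_leqP => -[s k] _; rewrite coefCM coefXn.
case: eqP => _; last by rewrite mulr0 size_poly0.
by rewrite mulr1; apply: leq_trans (size_scale_leq _ _) _; rewrite size_polyXn ltn_ord.
Qed.

Lemma A_ab : A = (ab false).['X^P] + d ^+ r.+1 * (ab true).['X^P].
Proof.
have -> : A = \sum_b \sum_si c (b, si) *: h (b, si).
  by rewrite pair_bigA; apply: eq_bigr => -[].
rewrite big_bool addrC; congr (_ + _); rewrite /ab horner_sum ?mulr_sumr; apply: eq_bigr => -[s i] _.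
  by rewrite /h /= expr1 hornerM hornerC hornerXn -exprM mulnC -scalerAl -scalerAr -exprD.
by rewrite /h /= expr0 mul1r hornerM hornerC hornerXn -exprM mulnC -scalerAl -exprD.
Qed.

(* Reading X^P as a new variable Z turns A = 0 into an identity
   a(X,Z)^2 = d(X) d(Z) b(X,Z)^2; its leading coefficient in Z contradicts
   d_nonsquare. *)
Lemma stepanov_neq0 : A != 0.
Proof.
apply/eqP; rewrite A_ab => A0.
set a := ab false in A0; set b := ab true in A0.
have l0 : (0 < l)%N by case: c_neq0 => -[_ [[s sl] _]] _; apply: leq_ltn_trans sl.
have Xd : coef_size_le D.+1 d%:P.
  move=> i; rewrite coefC; case: eqP => _; rewrite ?size_poly0 //.
  by rewrite prednK // ltnW.
have XdZ : coef_size_le 1 (map_poly polyC d).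
  by move=> i; rewrite coef_map /= size_polyC leq_b1.
have E : a ^+ 2 = d%:P * map_poly polyC d * b ^+ 2.
  apply/eqP; rewrite -subr_eq0; apply/eqP; apply: (@coef_size_le_horner_eq0 P).
    have la : coef_size_le l.-1.+1 a by rewrite prednK //; apply: coef_size_le_ab.
    have lb : coef_size_le l.-1.+1 b by rewrite prednK //; apply: coef_size_le_ab.
    apply: coef_size_leB.
      apply: coef_size_le_trans (coef_size_le_mul la la); move: lP l0; move: P; clear; lia.
    apply: coef_size_le_trans (coef_size_le_mul (coef_size_le_mul Xd XdZ) (coef_size_le_mul lb lb)).
    by move: lP l0; move: P; clear; lia.
  rewrite hornerD hornerN !hornerM hornerC -/(comp_poly 'X^P d) -pow_card_comp.
  move/eqP: A0; rewrite addr_eq0 => /eqP ->.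
  rewrite -!expr2 sqrrN exprMn -exprM (_ : (r.+1 * 2)%N = P.+1); first by rewrite exprS subrr.
  by rewrite muln2 doubleS [in RHS]half_odd_exp.
have lc : lead_coef a ^+ 2 = d * (lead_coef d)%:P * lead_coef b ^+ 2.
  have := congr1 lead_coef E; rewrite !expr2 !lead_coefM lead_coefC.
  by rewrite lead_coef_map_inj //; exact: polyC_inj.
have [|a0 b0] := d_nonsquare _ lc; first by rewrite lead_coef_eq0.
case: c_neq0 => -[[] si]; rewrite -coef_ab -/a -/b.
  by move/eqP: b0; rewrite lead_coef_eq0 => /eqP ->; rewrite !coef0 eqxx.
by move/eqP: a0; rewrite lead_coef_eq0 => /eqP ->; rewrite !coef0 eqxx.
Qed.

Lemma stepanov_root x : Frob (j + j) x = x ->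
  (d^io).[x] ^+ ((q ^ (j + j)).-1./2)%N = iota eps -> root (A^io) x.
Proof.
move=> Hx Hd; rewrite /root -(inj_eq (@Frob_inj j)) rmorph0 /=.
have -> : Frob j (A^io).[x] = ((\sum_i c i *: g i)^io).[x]; last by rewrite c_ker rmorph0 horner0.
have xP : x ^+ (P * P)%N = x by rewrite -expnD.
(* For P = 2r + 1, (r+1) P = (P^2 - 1)/2 + (r+1). *)
have dP : (d^io).[x] ^+ r.+1 ^+ P = iota eps * (d^io).[x] ^+ r.+1.
  rewrite -Hd -exprM -exprD; congr (_ ^+ _).
  rewrite expnD; set k := r; have Pe : P = k.*2.+1 := half_odd_exp j.
  clearbody k; rewrite Pe.
  have -> : ((k.*2.+1 * k.*2.+1).-1 = (2 * k * k + 2 * k).*2)%N by clear; rewrite -!muln2; lia.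
  by clear; rewrite doubleK -muln2; lia.
rewrite /A !rmorph_sum /= !horner_sum rmorph_sum; apply: eq_bigr => -[b [s i]] _.
rewrite /h /g /= !map_polyZ !rmorphM !rmorphXn /= map_polyZ !map_polyX !hornerZ !hornerM.
rewrite rmorphXn /= !horner_exp hornerZ hornerX horner_exp [LHS]rmorphM [X in _ * X]rmorphM.
rewrite [X in X * _]Frob_iota; congr (_ * (_ * _)).
  by case: b; rewrite ?expr1 ?expr0 ?rmorph1 // -[LHS]/(_ ^+ P).
by rewrite -[LHS]/(_ ^+ P) !exprD exprMn -!exprM -mulnA [(i * _)%N]mulnC [X in _ * X = _]exprM xP.
Qed.

End Stepanov.

Lemma stepanov_count j eps :
  (D <= (q ^ j)./2)%N -> (3 <= (q ^ j)./2)%N ->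
  (2 * count (fun x => (d^io).[x] ^+ ((q ^ (j + j)).-1./2)%N == iota eps)%R (Fixed (j + j))
    <= q ^ j * q ^ j + (6 * D + 6) * q ^ j)%N.
Proof.
move=> Dr r3; set P := (q ^ j)%N in Dr r3 *.
have Pr : P = (P./2).*2.+1 := half_odd_exp j.
have j0 : (0 < j)%N by case: (j) @P r3 {Dr Pr}.
(* [l] is as large as [lP] allows. [M] exceeds P/2 by only O(D), which keeps deg A at P^2/2 + O(P),
   yet 2lM - lP = l (4D+5) outweighs the remaining (r+1) D + M conditions because l >= r/2. *)
pose l := ((P - D)./2)%N; pose M := (P./2 + (2 * D + 3))%N.
have l1 : (l.*2 + D <= P)%N by rewrite /l; lia.
have l2 : (P./2 <= l.*2)%N by rewrite /l; lia.
have lM : (P./2.+1 * D + l * P + M < 2 * (l * M))%N.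
  rewrite /M; move: Pr l2 Dr r3; move: (P./2) => r -> l2 Dr r3.
  clear -l2 Dr r3.
  have : (r * (4 * D + 5) <= l.*2 * (4 * D + 5))%N by rewrite leq_mul2r l2 orbT.
  by rewrite -!muln2; nia.
have [c [c0 ck]] := stepanov_coef eps lM.
have A0 := stepanov_neq0 l1 c0.
have sA := stepanov_size j c.
have := stepanov_root ck.
move: A0 sA; set A := \sum_i _ => A0 sA rA.
have jj : (0 < j + j)%N by rewrite addn_gt0 j0.
have : (count (fun x => (d^io).[x] ^+ ((q ^ (j + j)).-1./2)%N == iota eps)%R (Fixed (j + j)) < size A)%N.
  rewrite -size_filter -(size_map_poly iota); apply: max_poly_roots.
  - by rewrite map_poly_eq0.
  - apply/allP => x; rewrite mem_filter mem_Fixed // => /andP[/eqP H /eqP Hx].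
    exact: rA.
  - by rewrite filter_uniq ?Fixed_uniq.
move: sA; rewrite -/P /M; move: (count _ _) (size A) => n sz sA nz.
move: Pr l1 Dr; move: (P./2) sA => r sA Pr l1 Dr; clear -sA Pr l1 nz Dr.
have : (n < r.+1 * D + l + (r + (2 * D + 3)) * P)%N by apply: leq_trans sA.
have : (2 * r + 1 = P)%N by rewrite Pr -mul2n addn1.
have : (2 * l + D <= P)%N by rewrite mul2n.
by clear; nia.
Qed.

(** The upper bounds for both signs suffice: the points with value 1, -1 and 0 add up to P^2 and at
    most D of them are zeros of d, so each upper bound is a lower bound for the opposite sign. *)
Lemma charsum_bound j : (D <= (q ^ j)./2)%N -> (3 <= (q ^ j)./2)%N ->
  `|charsum (j + j)| <= ((7 * D + 6) * q ^ j)%N%:Z.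
Proof.
move=> Dr r3; have j0 : (0 < j)%N by case: (j) r3.
have jj : (0 < j + j)%N by rewrite addn_gt0 j0.
pose dh (x : K) := (d^io).[x] ^+ ((q ^ (j + j)).-1./2)%N.
pose N0 := count (fun x => (d^io).[x] == 0) (Fixed (j + j)).
pose N1 := count (fun x => dh x == iota 1) (Fixed (j + j)).
pose N2 := count (fun x => dh x == iota (-1)) (Fixed (j + j)).
have B1 : (2 * N1 <= q ^ j * q ^ j + (6 * D + 6) * q ^ j)%N := stepanov_count 1 Dr r3.
have B2 : (2 * N2 <= q ^ j * q ^ j + (6 * D + 6) * q ^ j)%N := stepanov_count (-1) Dr r3.
have B0 : (N0 <= D)%N.
  rewrite -ltnS prednK ?(ltnW d_size) // -(size_map_poly iota) /N0 -size_filter.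
  apply: max_poly_roots; rewrite ?map_poly_eq0 ?filter_uniq ?Fixed_uniq //.
  by apply/allP => x; rewrite mem_filter => /andP[].
have key x : x \in Fixed (j + j) ->
   quadchar (Fnorm (j + j) (d^io).[x]) = (dh x == iota 1)%:Z - (dh x == iota (-1))%:Z
   /\ (((d^io).[x] == 0)%R + (dh x == iota 1)%R + (dh x == iota (-1))%R = 1)%N.
  rewrite mem_Fixed // => /eqP Hx; rewrite rmorphN rmorph1 /quadchar Fnorm_eq0 // Fnorm_exp -/(dh x).
  have Fd : Frob (j + j) (d^io).[x] = (d^io).[x] by rewrite Frob_horner Hx.
  have := quadchar_Fnorm jj Fd; rewrite -/(dh x) /quadchar Fnorm_eq0 // Fnorm_exp -/(dh x).
  have N := neq_opp1.
  case: eqP => [_ <-|_]; first by rewrite !rmorph0 ![0 == _]eq_sym oppr_eq0 !oner_eq0.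
  case: (dh x =P 1) => [-> _|_ <-]; first by rewrite eq_sym (negPf N).
  by rewrite rmorphN rmorph1 eqxx.
have E1 : charsum (j + j) = N1%:Z - N2%:Z.
  rewrite /charsum /N1 /N2 -!sum1_count !(big_mkcond (fun x => dh x == _)) /=.
  rewrite -!natz !natr_sum -sumrB !big_seq; apply: eq_bigr => x /key[-> _].
  by rewrite !natz; case: eqP; case: eqP.
have E2 : (N0 + N1 + N2 = q ^ j * q ^ j)%N.
  rewrite -expnD -size_Fixed // -sum1_size /N0 /N1 /N2 -!sum1_count.
  rewrite !(big_mkcond (fun x => dh x == _)) (big_mkcond (fun x => _.[x] == _)) /= -!big_split /=.
  rewrite !big_seq; apply: eq_bigr => x /key[_].
  by case: eqP; case: eqP; case: eqP.
rewrite E1; move: B0 B1 B2 E2; clear.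
move: (N0) (N1) (N2) (q ^ j)%N => n0 n1 n2 P.
have : (D <= D * P \/ P = 0)%N by case: P => [|P]; [right|left; rewrite leq_pmulr].
by move: D => e; lia.
Qed.

End Frobenius.

(** * Power sums and inverse roots *)

Section Norm.
Variable R : realType.
Local Notation C := R[i].
Local Notation nrm := (@Normc.normc R).
Implicit Types z w : C.

Lemma nrm_ge0 z : 0 <= nrm z.
Proof. by case: z => a b; apply: sqrtr_ge0. Qed.

Lemma nrmE z : `|z| = (nrm z)%:C%C. Proof. by []. Qed.

Lemma nrmM z w : nrm (z * w) = nrm z * nrm w. Proof. exact: Normc.normcM. Qed.
Lemma nrm1 : nrm 1 = 1. Proof. exact: Normc.normc1. Qed.
Lemma nrm0 : nrm 0 = 0. Proof. exact: Normc.normc0. Qed.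
Lemma nrm_eq0 z : (nrm z == 0) = (z == 0).
Proof. by apply/eqP/eqP => [/Normc.eq0_normc //|->]; rewrite nrm0. Qed.
Lemma nrmX z n : nrm (z ^+ n) = nrm z ^+ n.
Proof. by elim: n => [|n IH]; rewrite ?expr0 ?nrm1 // !exprS nrmM IH. Qed.
Lemma nrmD z w : nrm (z + w) <= nrm z + nrm w.
Proof. by have := ler_normD z w; rewrite !nrmE -rmorphD /= lecR. Qed.
Lemma nrmN z : nrm (- z) = nrm z.
Proof. by case: z => a b /=; rewrite !sqrrN. Qed.
Lemma nrm_sum (I : Type) (s : seq I) (f : I -> C) :
  nrm (\sum_(i <- s) f i) <= \sum_(i <- s) nrm (f i).
Proof.
elim: s => [|i s IH]; first by rewrite !big_nil nrm0.
by rewrite !big_cons; apply: le_trans (nrmD _ _) _; rewrite lerD2l.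
Qed.
Lemma nrm_prod (I : Type) (s : seq I) (f : I -> C) :
  nrm (\prod_(i <- s) f i) = \prod_(i <- s) nrm (f i).
Proof.
elim: s => [|i s IH]; first by rewrite !big_nil nrm1.
by rewrite !big_cons nrmM IH.
Qed.
Lemma nrmMn z n : nrm (z *+ n) = nrm z *+ n.
Proof.
apply: (@complexI R); rewrite rmorphMn /= -nrmE normrMn //.
Qed.
Lemma nrm_sqr z : nrm z ^+ 2 = complex.Re z ^+ 2 + complex.Im z ^+ 2.
Proof. by case: z => a b; rewrite sqr_sqrtr // addr_ge0 ?sqr_ge0. Qed.
Lemma nrm_real (x : R) : nrm x%:C%C = `|x|.
Proof. by rewrite /Normc.normc /= expr0n /= addr0 sqrtr_sqr. Qed.
Lemma ReD z w : complex.Re (z + w) = complex.Re z + complex.Re w.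
Proof. by case: z w => [? ?] [? ?]. Qed.
Lemma Re_sum (I : Type) (s : seq I) (f : I -> C) :
  complex.Re (\sum_(i <- s) f i) = \sum_(i <- s) complex.Re (f i).
Proof.
by elim: s => [|i s IH]; rewrite ?big_nil // !big_cons ReD IH.
Qed.
Lemma Re_le z : `|complex.Re z| <= nrm z.
Proof.
rewrite -(@ler_pXn2r _ 2) // ?nnegrE ?nrm_ge0 ?normr_ge0 //.
by rewrite nrm_sqr real_normK ?num_real // lerDl sqr_ge0.
Qed.
Lemma ReZ (x : R) z : complex.Re (x%:C%C * z) = x * complex.Re z.
Proof. by case: z => a b /=; rewrite mul0r subr0. Qed.

(** Otherwise (x/y)^j would be unbounded, by Bernoulli's inequality. *)
Lemma geometric_bound (x y c : R) j0 : 0 <= x -> 0 < y ->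
  (forall j, (j0 <= j)%N -> x ^+ j <= c * y ^+ j) -> x <= y.
Proof.
move=> x0 y0 H; rewrite leNgt; apply/negP => yx.
pose t := x / y - 1.
have t0 : 0 < t by rewrite subr_gt0 ltr_pdivlMr // mul1r.
have B n : 1 + n%:R * t <= (1 + t) ^+ n.
  elim: n => [|n IH]; first by rewrite mul0r addr0.
  rewrite exprS; apply: le_trans (ler_wpM2l _ IH); last by apply/ltW/addr_gt0.
  rewrite -natr1; have : 0 <= t * (n%:R * t) by rewrite !mulr_ge0 // ltW.
  by nra.
pose n := Num.Def.truncn `|c / t|.
have := H (j0 + n.+1)%N (leq_addr _ _).
rewrite -ler_pdivrMr ?exprn_gt0 // -expr_div_n => H2.
have := le_trans (B _) _; move=> /(_ (j0 + n.+1)%N c).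
have -> : 1 + t = x / y by rewrite /t addrCA subrr addr0.
move=> /(_ H2); apply/negP; rewrite -ltNge.
have : c / t < n.+1%:R by apply: le_lt_trans (ler_norm _) _; apply: truncnS_gt.
rewrite ltr_pdivrMr // => ct.
have : n.+1%:R * t <= (j0 + n.+1)%:R * t by rewrite ler_wpM2r ?ler_nat ?leq_addl // ltW.
by lra.
Qed.

(* A polynomial g vanishing on s except at b isolates b^j g(b) as a fixed linear
   combination of power sums. *)
Lemma power_sum_bound (s : seq C) (y c : R) j0 : 0 < y ->
  (forall j, (j0 <= j)%N -> nrm (\sum_(a <- s) a ^+ j) <= c * y ^+ j) ->
  forall a, a \in s -> nrm a <= y.
Proof.
move=> y0 H b bs.
pose g : {poly C} := \prod_(a <- [seq a <- undup s | a != b]) ('X - a%:P).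
have gb : g.[b] != 0.
  rewrite -/(root g b) root_prod_XsubC mem_filter eqxx //.
have gz a : a \in s -> a != b -> g.[a] = 0.
  by move=> sa ab; apply/rootP; rewrite root_prod_XsubC mem_filter ab mem_undup.
have E j : \sum_(k < size g) g`_k * \sum_(a <- s) a ^+ (j + k) = (b ^+ j * g.[b]) *+ count_mem b s.
  under eq_bigr do rewrite mulr_sumr.
  rewrite exchange_big /= -sum1_count [in RHS]big_mkcond -sumrMnr big_seq [RHS]big_seq; apply: eq_bigr => a sa.
  transitivity (a ^+ j * g.[a]).
    by rewrite horner_coef mulr_sumr; apply: eq_bigr => k _; rewrite exprD mulrCA.
  by rewrite /=; case: (a =P b) => [->|/eqP ab]; rewrite ?mulr1n // (gz a) ?mulr0 ?mulr0n.
have m0 : (0 < count_mem b s)%N by rewrite -has_count has_pred1.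
have gb0 : 0 < nrm g.[b] by rewrite lt_def nrm_ge0 andbT nrm_eq0.
apply: (@geometric_bound _ _ ((\sum_(k < size g) nrm g`_k * c * y ^+ k) / nrm g.[b]) j0) => //.
  exact: nrm_ge0.
move=> j jj; rewrite mulrAC ler_pdivlMr //.
apply: (@le_trans _ _ (nrm ((b ^+ j * g.[b]) *+ count_mem b s))).
  by rewrite nrmMn nrmM nrmX -[X in _ <= X]mulr_natl ler_peMl ?ler1n // mulr_ge0 ?exprn_ge0 ?nrm_ge0.
rewrite -E; apply: le_trans (nrm_sum _ _) _; rewrite mulr_suml; apply: ler_sum => k _.
rewrite nrmM -!mulrA ler_wpM2l ?nrm_ge0 // -exprD addnC.
by apply: H; apply: leq_trans jj (leq_addl _ _).
Qed.
End Norm.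

(** * Newton's identities *)

Section Newton.
Variable C : closedFieldType.

Lemma split_one_sub (W : {poly C}) : W.[0] = 1 ->
  exists2 s : seq C, W = \prod_(a <- s) (1 - a *: 'X) & (size s < size W)%N.
Proof.
move=> W0; have [t E] := closed_field_poly_normal W.
have Wn0 : W != 0 by apply: contra_eq_neq W0 => ->; rewrite horner0 eq_sym oner_eq0.
have t0 z : z \in t -> z != 0.
  move=> zt; apply: contra_eq_neq W0 => z0.
  by rewrite E hornerZ (rootP _) ?mulr0 1?eq_sym ?oner_eq0 // root_prod_XsubC -z0.
exists [seq z^-1 | z <- t]; last first.
  by rewrite size_map E size_scale ?lead_coef_eq0 // size_prod_XsubC.
have E2 : W = (lead_coef W * \prod_(z <- t) (- z)) *: \prod_(a <- [seq z^-1 | z <- t]) (1 - a *: 'X).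
  rewrite {1}E -scalerA; congr (_ *: _); rewrite -mul_polyC rmorph_prod /= big_map -big_split /=.
  rewrite !big_seq; apply: eq_bigr => z /t0 z0.
  by rewrite mulrBr mulr1 mul_polyC scalerA mulNr mulfV // scaleN1r polyCN opprK addrC.
move/(congr1 (fun p => p.[0])): (E2); rewrite W0 hornerZ horner_prod.
rewrite [X in _ = _ * X]big1_seq ?mulr1 => [H|a _]; first by rewrite {1}E2 -H scale1r.
by rewrite !hornerE ?mulr0 ?oppr0 ?subr0 ?addr0.
Qed.

(** Induction on the list: the power sums of a newly added a, multiplied by the factor 1 - aX,
    telescope to a single coefficient. *)
Lemma newton (s : seq C) n :
  n%:R * (\prod_(a <- s) (1 - a *: 'X))`_n =
  - \sum_(k < n) (\sum_(a <- s) a ^+ k.+1) * (\prod_(a <- s) (1 - a *: 'X))`_(n - k.+1).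
Proof.
elim: s n => [|a s IH] n.
  rewrite big_nil; case: n => [|n]; first by rewrite mul0r big_ord0 oppr0.
  by rewrite coef1 mulr0 big1 ?oppr0 // => k _; rewrite big_nil mul0r.
rewrite big_cons; set T := \prod_(_ <- s) _ in IH *.
have Q m : ((1 - a *: 'X) * T)`_m.+1 = T`_m.+1 - a * T`_m.
  by rewrite mulrBl mul1r -scalerAl coefB coefZ coefXM.
have Q0 : ((1 - a *: 'X) * T)`_0 = T`_0.
  by rewrite mulrBl mul1r -scalerAl coefB coefZ coefXM mulr0 subr0.
case: n => [|n]; first by rewrite mul0r big_ord0 oppr0.
have tel m : \sum_(k < m.+1) a ^+ k.+1 * ((1 - a *: 'X) * T)`_(m.+1 - k.+1) = a * T`_m.
  elim: m => [|m IHm]; first by rewrite big_ord1 subnn Q0 expr1.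
  rewrite big_ord_recl /= subn1 /= Q expr1.
  under eq_bigr => k _ do rewrite /bump /= add1n subSS exprS -mulrA.
  by rewrite -mulr_sumr IHm; ring.
under eq_bigr => k _ do rewrite big_cons mulrDl.
rewrite big_split /= tel.
have -> : \sum_(k < n.+1) (\sum_(j <- s) j ^+ k.+1) * ((1 - a *: 'X) * T)`_(n.+1 - k.+1)
   = - (n.+1%:R * T`_n.+1) + a * (n%:R * T`_n).
  rewrite (IH n.+1) (IH n) opprK mulrN big_ord_recr /= subnn Q0 [in RHS]big_ord_recr /= subnn.
  rewrite addrAC; congr (_ + _); rewrite mulr_sumr -sumrB; apply: eq_bigr => k _.
  have kn := ltn_ord k.
  have e : (n.+1 - k.+1)%N = (n - k.+1).+1 by lia.
  by rewrite e Q; ring.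
by rewrite Q -natr1; ring.
Qed.

(** As A_0 = 1, the recursion determines S from A, and Newton's identities say that the negated
    power sums satisfy the same recursion. *)
Lemma power_sums_eq (s : seq C) (A S : nat -> C) : A 0%N = 1 ->
  (forall n, A n = (\prod_(a <- s) (1 - a *: 'X))`_n) ->
  (forall n, n%:R * A n = \sum_(k < n) S k.+1 * A (n - k.+1)%N) ->
  forall k, S k.+1 = - \sum_(a <- s) a ^+ k.+1.
Proof.
move=> A0 AE rec; elim/ltn_ind => k IH.
have := rec k.+1; rewrite [in LHS]AE newton !big_ord_recr /= subnn -AE A0 !mulr1 => E.
have E2 : \sum_(i < k) S i.+1 * A (k.+1 - i.+1)%N =
   - \sum_(i < k) (\sum_(a <- s) a ^+ i.+1) * (\prod_(a <- s) (1 - a *: 'X))`_(k.+1 - i.+1).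
  by rewrite -sumrN; apply: eq_bigr => i _; rewrite IH // AE mulNr.
by move: E; rewrite E2 opprD => /addrI ->.
Qed.
End Newton.

(** * A trigonometric majorant of the logarithm *)

(** Closed form of the Fejer-weighted geometric sum, which governs the derivative of [Pk]. *)
Lemma fejer_sum (A : comNzRingType) (z : A) N :
  (1 - z) ^+ 2 * \sum_(k < N) (N - k)%:R * z ^+ k = N.+1%:R * (1 - z) - 1 + z ^+ N.+1.
Proof.
elim: N => [|N IH]; first by rewrite big_ord0 mulr0 expr1; ring.
rewrite big_ord_recl subn0 expr0 mulr1 mulrDr.
under eq_bigr => k _ do rewrite lift0 subSS exprS mulrCA.
rewrite -mulr_sumr mulrCA IH -[N.+2%:R]natr1 !exprS.
rewrite -[X in _ = (X + 1) * _ - _ + _]/(N.+1%:R).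
by ring.
Qed.

Section Majorant.
Variable R : realType.
Local Notation C := R[i].
Local Notation nrm := (@Normc.normc R).
Variables (N : nat) (w : C).
Hypothesis w1 : nrm w <= 1.

Let a := complex.Re w.
Let s := nrm w ^+ 2.
Let c : R := N.+1%:R^-1.
Let M : {poly R} := 1 - (2 * a) *: 'X + s *: 'X^2.
Let Q : {poly R} := 1 - a *: 'X.
(** The Fejer-weighted truncation of -ln|1 - xw|. Along the segment, [M] is |1 - xw|^2 and Q/M is
    the real part of 1/(1 - xw). *)
Let Pk : {poly R} :=
  \sum_(k < N) (c * (N - k)%:R / k.+1%:R * complex.Re (w ^+ k.+1)) *: 'X^(k.+1).

Lemma ME (x : R) : M.[x] = nrm (1 - x%:C%C * w) ^+ 2.
Proof.
rewrite /M /s !nrm_sqr /a; case: w => p t /=; rewrite !hornerE /=; ring.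
Qed.

Lemma s_le1 : s <= 1.
Proof. by rewrite /s expr_le1 // nrm_ge0. Qed.

Lemma u_gt0 (x : R) : 0 <= x -> x < 1 -> 0 < nrm (1 - x%:C%C * w).
Proof.
move=> x0 x1; rewrite lt_def nrm_ge0 andbT nrm_eq0 subr_eq0; apply/eqP => /(congr1 nrm).
rewrite nrm1 nrmM nrm_real ger0_norm // => E.
have : x * nrm w <= x * 1 by rewrite ler_wpM2l.
by lra.
Qed.

Lemma M_gt0 (x : R) : 0 <= x -> x < 1 -> 0 < M.[x].
Proof. by move=> x0 x1; rewrite ME exprn_gt0 // u_gt0. Qed.

Lemma derivPk (x : R) : Pk^`().[x] = complex.Re (c%:C%C * w * \sum_(k < N) (N - k)%:R * (x%:C%C * w) ^+ k).
Proof.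
rewrite /Pk raddf_sum /= horner_sum mulr_sumr Re_sum; apply: eq_bigr => k _.
rewrite derivZ derivXn hornerZ hornerMn hornerXn.
have -> : c%:C%C * w * ((N - k)%:R * (x%:C%C * w) ^+ k) = (c * (N - k)%:R * x ^+ k)%:C%C * w ^+ k.+1.
  by rewrite exprMn exprS !rmorphM rmorph_nat rmorphXn /=; ring.
rewrite ReZ -mulr_natr; field.
by rewrite nat1r pnatr_eq0.
Qed.

Lemma Re_div_u (x : R) : 0 <= x -> x < 1 ->
  complex.Re (- (w / (1 - x%:C%C * w))) = 2^-1 * (M^`().[x] / M.[x]).
Proof.
move=> x0 x1; have := M_gt0 x0 x1; rewrite ME.
have -> : M^`().[x] = - (2 * a) + s * (x *+ 2).
  rewrite /M !poly.derivE !hornerE /=; ring.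
rewrite /s !nrm_sqr /a; case: w => p t /=; rewrite !mul0r !subr0 !addr0 sub0r => m0.
field; exact: lt0r_neq0.
Qed.

Lemma Re_div_u2 (x : R) : 0 <= x -> x < 1 ->
  complex.Re (w / (1 - x%:C%C * w) ^+ 2) = - a / M.[x] - Q.[x] * M^`().[x] / M.[x] ^+ 2.
Proof.
move=> x0 x1; have := M_gt0 x0 x1; rewrite ME.
have -> : M^`().[x] = - (2 * a) + s * (x *+ 2).
  by rewrite /M !poly.derivE !hornerE /=; ring.
have -> : Q.[x] = 1 - a * x by rewrite /Q !hornerE.
rewrite (_ : w / _ = w * (1 - x%:C%C * w)^-1 * (1 - x%:C%C * w)^-1); last by rewrite expr2 invfM mulrA.
rewrite /s !nrm_sqr /a; case: w => p t /=; rewrite !mul0r !subr0 !addr0 sub0r => m0.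
field; exact: lt0r_neq0.
Qed.

(** By [fejer_sum], the derivative of c Re 1/(1 - xw) cancels everything except a term carrying
    z^(N+1), z = xw. *)
Lemma Re_deriv (x : R) : 0 <= x -> x < 1 ->
  2^-1 * (M^`().[x] / M.[x]) + Pk^`().[x] + c * (- a / M.[x] - Q.[x] * M^`().[x] / M.[x] ^+ 2)
  <= c * x ^+ N.+1 / M.[x].
Proof.
move=> x0 x1; have u0 := u_gt0 x0 x1.
rewrite -Re_div_u // derivPk -Re_div_u2 // -ReZ -!ReD.
set z := x%:C%C * w; rewrite -/z in u0.
have zu : 1 - z != 0 by rewrite -nrm_eq0 gt_eqF.
have cN : c%:C%C * N.+1%:R = 1 :> C.
  by rewrite /c fmorphV rmorph_nat mulVf // pnatr_eq0.
have -> : - (w / (1 - z)) + c%:C%C * w * (\sum_(k < N) (N - k)%:R * z ^+ k) + c%:C%C * (w / (1 - z) ^+ 2)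
   = c%:C%C * w * z ^+ N.+1 / (1 - z) ^+ 2.
  have -> : z ^+ N.+1 = (1 - z) ^+ 2 * \sum_(k < N) (N - k)%:R * z ^+ k - N.+1%:R * (1 - z) + 1.
    by rewrite fejer_sum; ring.
  have -> : c%:C%C * w * ((1 - z) ^+ 2 * \sum_(k < N) (N - k)%:R * z ^+ k - N.+1%:R * (1 - z) + 1)
    = c%:C%C * w * (1 - z) ^+ 2 * (\sum_(k < N) (N - k)%:R * z ^+ k)
      - (c%:C%C * N.+1%:R) * w * (1 - z) + c%:C%C * w by ring.
  by rewrite cN; field.
apply: le_trans (ler_norm _) _; apply: le_trans (Re_le _) _.
rewrite !nrmM Normc.normcV !nrmX nrmM -ME !nrm_real ger0_norm ?(ger0_norm x0); last by rewrite invr_ge0.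
have M0 := M_gt0 x0 x1.
rewrite ler_wpM2r ?invr_ge0 ?(ltW M0) // -mulrA ler_wpM2l ?invr_ge0 //.
rewrite exprMn mulrCA -exprS ler_piMr ?exprn_ge0 // expr_le1 ?nrm_ge0 //.
Qed.

Section Radius.
Variable r : R.
Hypotheses (r0 : 0 <= r) (r1 : r < 1).
Hypothesis Hr : 8 * r ^+ N.+2 <= N.+2%:R * (1 - r ^+ 2).

(** |1 - rw| <= |1 - xw| + (r - x), and r - x <= 1 - x <= |1 - xw|. The error term then has a
    constant denominator and integrates to a power of x. *)
Lemma M_quarter (x : R) : 0 <= x -> x <= r -> M.[r] <= 4 * M.[x].
Proof.
move=> x0 xr; have x1 := le_lt_trans xr r1.
have H : nrm (1 - r%:C%C * w) <= 2 * nrm (1 - x%:C%C * w).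
  have E : 1 - r%:C%C * w = (1 - x%:C%C * w) + - ((r - x)%:C%C * w) by rewrite rmorphB /=; ring.
  have H1 : nrm (1 - r%:C%C * w) <= nrm (1 - x%:C%C * w) + (r - x).
    rewrite E; apply: le_trans (nrmD _ _) _; rewrite lerD2l nrmN nrmM nrm_real.
    by rewrite ger0_norm ?subr_ge0 // ler_piMr // subr_ge0.
  have H2 : 1 <= nrm (1 - x%:C%C * w) + x.
    rewrite -nrm1 -{1}[1](subrK (x%:C%C * w)); apply: le_trans (nrmD _ _) _.
    by rewrite lerD2l nrmM nrm_real ger0_norm // ler_piMr.
  have H3 := r1; move: H1 H2 H3; move: (nrm (1 - r%:C%C * w)) (nrm (1 - x%:C%C * w)) => A B H1 H2 H3; lra.
rewrite !ME (_ : 4 * _ = (2 * nrm (1 - x%:C%C * w)) ^+ 2); last by ring.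
by rewrite ler_pXn2r // nnegrE ?mulr_ge0 ?nrm_ge0.
Qed.

Let b := 4 * c / (N.+2%:R * M.[r]).
(* The derivative of the first three terms is
   Re (c w z^(N+1) / (1 - z)^2) with z = x w, which the last term dominates. *)
Let E (x : R) := 2^-1 * ln M.[x] + Pk.[x] + c * (Q.[x] / M.[x]) - b * x ^+ N.+2.

Lemma E_derive (x : R) : 0 <= x -> x < 1 -> is_derive x (1 : R) E
  (2^-1 * (M^`().[x] / M.[x]) + Pk^`().[x] + c * (- a / M.[x] - Q.[x] * M^`().[x] / M.[x] ^+ 2)
    - b * (N.+2%:R * x ^+ N.+1)).
Proof.
move=> x0 x1; have M0 := M_gt0 x0 x1.
have D1 : is_derive x (1 : R) (fun y => ln M.[y]) (M^`().[x] / M.[x]).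
  have := @is_derive1_comp R (@ln R) (horner M) x _ _ (is_derive1_ln M0) (is_derive_poly M x).
  by rewrite mulrC; apply.
have D2 : is_derive x (1 : R) (fun y => (M.[y])^-1) (- M.[x] ^- 2 *: M^`().[x]).
  by apply: is_deriveV; rewrite gt_eqF.
have D3 : is_derive x (1:R) (horner Q) (- a).
  have := is_derive_poly Q x; rewrite (_ : Q^`().[x] = - a) //.
  by rewrite /Q !poly.derivE !hornerE /=; ring.
have D4 := is_derive_poly Pk x.
have D5 := is_derive_poly (b *: 'X^(N.+2)) x.
have EE : E = 2^-1 *: (fun y => ln M.[y]) + horner Pk + c *: (horner Q * (fun y => (M.[y])^-1)) - horner (b *: 'X^(N.+2)).
  by apply/funext => y; rewrite /E !fctE /= hornerZ hornerXn.
have D := is_deriveB (is_deriveD (is_deriveD (is_deriveZ (2^-1) D1) D4) (is_deriveZ c (is_deriveM D3 D2))) D5.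
rewrite EE; apply: (@is_derive_eq _ _ _ _ _ _ _ _ D).
rewrite derivZ hornerZ derivXn hornerMn hornerXn /=.
rewrite /GRing.scale /= -[_ *+ N.+2]mulr_natl; field; exact: lt0r_neq0.
Qed.

Lemma E_le0 : E r <= E 0.
Proof.
have D x : x \in `]0, r[ -> 0 <= x /\ x < 1.
  by rewrite in_itv /= => /andP[x0 xr]; split; [exact: ltW | exact: lt_trans r1].
have := @ler0_derive1_nincr R E 0 r _ _ _ 0 r (lexx 0) r0 (lexx r); apply.
- by move=> x /D[x0 x1]; have [] := E_derive x0 x1.
- move=> x xr; have [x0 x1] := D x xr.
  have xr' : x <= r by move: xr; rewrite in_itv /= => /andP[_ /ltW].
  rewrite derive1E; have [_ ->] := E_derive x0 x1.
  rewrite subr_le0; apply: le_trans (Re_deriv x0 x1) _.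
  have -> : b * (N.+2%:R * x ^+ N.+1) = c * x ^+ N.+1 * (4 / M.[r]).
    have n20 : N.+2%:R != 0 :> R by rewrite pnatr_eq0.
    have Mr0 : M.[r] != 0 by rewrite gt_eqF ?M_gt0.
    rewrite /b; move: n20 Mr0; move: (N.+2%:R) M.[r] => n2 Mr n20 Mr0.
    by field; rewrite Mr0.
  apply: ler_wpM2l; first by rewrite mulr_ge0 ?exprn_ge0 ?invr_ge0.
  by rewrite ler_pdivlMr ?M_gt0 // mulrC ler_pdivrMr ?M_gt0 // M_quarter.
- apply: derivable_within_continuous => x; rewrite in_itv /= => /andP[x0 xr].
  by have [] := E_derive x0 (le_lt_trans xr r1).
Qed.

(** Q/M is 1/2 plus half a Poisson kernel. The 1/2 lowers c to c/2, and the positive kernel, at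
    least (1 - r^2)/(2M), absorbs the error b r^(N+2); [Hr] is exactly this comparison. *)
Lemma ln_u_le : ln (nrm (1 - r%:C%C * w)) <= c / 2 - Pk.[r].
Proof.
have M0 := M_gt0 r0 r1.
have c0 : 0 < c by rewrite invr_gt0 ltr0n.
have E0 : E 0 = c.
  rewrite /E expr0n mulr0 subr0 /M /Q /Pk horner_sum big1 => [|k _]; last first.
    by rewrite hornerZ hornerXn expr0n mulr0.
  by rewrite !hornerE /= ?mulr0 ?subr0 ?addr0 ln1 mulr0 add0r invr1 !mulr1.
have lnM : ln M.[r] = 2 * ln (nrm (1 - r%:C%C * w)).
  by rewrite ME lnXn ?u_gt0 // mulr_natl.
have Eb : b * r ^+ N.+2 <= c * ((1 - r ^+ 2) / (2 * M.[r])).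
  have n2 : 0 < N.+2%:R :> R by rewrite ltr0n.
  have -> : b * r ^+ N.+2 = c * (8 * r ^+ N.+2 / N.+2%:R / (2 * M.[r])).
    have Mr0 : M.[r] != 0 by rewrite gt_eqF.
    have n20 : N.+2%:R != 0 :> R by rewrite gt_eqF.
    rewrite /b; move: n20 Mr0; move: (r ^+ _) (N.+2%:R) M.[r] => rr m Mr m0 Mr0.
    by field; rewrite Mr0 m0.
  rewrite ler_pM2l // ler_pM2r ?invr_gt0 ?mulr_gt0 //.
  by rewrite ler_pdivrMr // [X in _ <= X]mulrC.
have EQ : 2^-1 + (1 - r ^+ 2) / (2 * M.[r]) <= Q.[r] / M.[r].
  rewrite -subr_ge0; have -> : Q.[r] / M.[r] - (2^-1 + (1 - r ^+ 2) / (2 * M.[r])) = r ^+ 2 * (1 - s) / (2 * M.[r]).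
    have Me : M.[r] = 1 - 2 * a * r + s * r ^+ 2 by rewrite /M !hornerE.
    have Qe : Q.[r] = 1 - a * r by rewrite /Q !hornerE.
    have Mn : 1 - 2 * a * r + s * r ^+ 2 != 0 by rewrite -Me gt_eqF.
    by rewrite Qe Me; field.
  by rewrite divr_ge0 ?mulr_ge0 ?sqr_ge0 ?subr_ge0 ?s_le1 // ltW.
have := E_le0; rewrite E0 /E lnM.
have : c * (2^-1 + (1 - r ^+ 2) / (2 * M.[r])) <= c * (Q.[r] / M.[r]) by rewrite ler_pM2l.
rewrite mulrDr; move: Eb.
move: (b * _) (c * (Q.[r] / M.[r])) (c * ((1 - r ^+ 2) / (2 * M.[r]))) (ln _) Pk.[r] => *.
by lra.
Qed.

(** Passage from radius r back to w. As w = 1 is allowed, the logarithm is given up here and the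
    bounds that follow are in exponential form. *)
Lemma u_compare : (1 + r) * nrm (1 - w) <= 2 * nrm (1 - r%:C%C * w).
Proof.
have p0 : 0 <= 1 + r by rewrite addr_ge0.
rewrite -(@ler_pXn2r _ 2) // ?nnegrE ?mulr_ge0 ?nrm_ge0 //.
have e1 : 1 - w = 1 - 1%:C%C * w by rewrite rmorph1 mul1r.
have Mx x : M.[x] = 1 - 2 * a * x + s * x ^+ 2 by rewrite /M !hornerE.
rewrite !exprMn -ME e1 -ME !Mx -subr_ge0.
have -> : 2 ^+ 2 * (1 - 2 * a * r + s * r ^+ 2) - (1 + r) ^+ 2 * (1 - 2 * a * 1 + s * 1 ^+ 2)
   = (1 - r) * ((3 * r + 1) * (1 - s) + 2 * (1 - r) * (1 + a)) by ring.
apply: mulr_ge0; first by rewrite subr_ge0 ltW.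
apply: addr_ge0.
  by rewrite mulr_ge0 ?subr_ge0 ?s_le1 // addr_ge0 // mulr_ge0.
rewrite mulr_ge0 //; first by rewrite mulr_ge0 // subr_ge0 ltW.
by have := le_trans (Re_le w) w1; rewrite ler_norml -/a => /andP[]; lra.
Qed.

Lemma majorant_radius : nrm (1 - w) <= expR ((1 - r) / (1 + r) + c / 2 - Pk.[r]).
Proof.
have p0 : 0 < 1 + r by rewrite ltr_pwDl.
have H : nrm (1 - w) <= 2 / (1 + r) * nrm (1 - r%:C%C * w).
  by rewrite mulrAC ler_pdivlMr // mulrC u_compare.
apply: le_trans H _; rewrite -addrA expRD ler_pM ?divr_ge0 ?nrm_ge0 ?(ltW p0) //.
  have -> : 2 / (1 + r) = 1 + (1 - r) / (1 + r) by field; rewrite gt_eqF.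
  exact: expR_ge1Dx.
by rewrite -[X in X <= _]lnK ?posrE ?u_gt0 // ler_expR ln_u_le.
Qed.
End Radius.

Let n : R := N.+2%:R.
(** Bernoulli gives r^n <= 1/5, enough for [Hr], while the radius costs (1-r)/(1+r) = 2/(N+4) <= 2c.
    With c/2 this makes 5/2. *)
Let r := n / (n + 4).

Lemma majorant : nrm (1 - w) <= expR (5 / 2 * c - Pk.[r]).
Proof.
have n2 : 2 <= n by rewrite /n ler_nat.
have n0 : 0 < n by lra.
have n4 : 0 < n + 4 by lra.
have r0 : 0 <= r by rewrite divr_ge0 // ltW.
have r1 : r < 1 by rewrite ltr_pdivrMr // mul1r ltrDl.
have B m (x : R) : 0 <= x -> 1 + m%:R * x <= (1 + x) ^+ m.
  move=> x0; elim: m => [|m IH]; first by rewrite mul0r addr0.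
  rewrite exprS; apply: le_trans (ler_wpM2l _ IH); last by rewrite addr_ge0.
  rewrite -natr1; have : 0 <= x * (m%:R * x) by rewrite !mulr_ge0.
  by nra.
have rn : r ^+ N.+2 <= 5^-1.
  have : 5 <= (r^-1) ^+ N.+2.
    have -> : r^-1 = 1 + 4 / n by rewrite /r; field; rewrite !gt_eqF.
    apply: le_trans (B _ _ _); last by rewrite divr_ge0 // ltW.
    by rewrite -/n mulrCA mulfV ?gt_eqF // mulr1; lra.
  by rewrite exprVn => H; rewrite -[X in X <= _]invrK lef_pV2 ?posrE // (lt_le_trans _ H).
have Hr : 8 * r ^+ N.+2 <= N.+2%:R * (1 - r ^+ 2).
  apply: (@le_trans _ _ (8 / 5)); first by rewrite ler_pM2l.
  rewrite -/n; have -> : n * (1 - r ^+ 2) = 4 * r * (1 + r) by rewrite /r; field; rewrite gt_eqF.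
  have r3 : 3^-1 <= r by rewrite /r ler_pdivlMr //; lra.
  by nra.
apply: le_trans (majorant_radius r0 r1 Hr) _; rewrite ler_expR lerD2r.
suff : (1 - r) / (1 + r) <= 2 * c by lra.
have -> : (1 - r) / (1 + r) = 2 / (n + 2).
  by rewrite /r; field; rewrite !gt_eqF //; lra.
rewrite ler_pM2l // /c lef_pV2 ?posrE ?ltr0n //; last by lra.
by rewrite /n -natrD ler_nat; lia.
Qed.
End Majorant.

(** * The bound for L *)

Section RiemannHypothesisBound.
Variable R : realType.
Local Notation C := R[i].
Local Notation nrm := (@Normc.normc R).
Variables (q D : nat) (A S : nat -> int).
Hypotheses (q1 : (2 < q)%N) (D1 : (1 < D)%N) (A0 : A 0%N = 1).
Hypothesis A_vanish : forall n, (D <= n)%N -> A n = 0.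
Hypothesis A_rec : forall n, n%:Z * A n = \sum_(1 <= k < n.+1) S k * A (n - k)%N.
Hypothesis S_le : forall k, (0 < k)%N -> `|S k| <= (q ^ k)%:Z.
Variables (K j0 : nat).
Hypothesis S_even : forall j, (j0 <= j)%N -> `|S (j + j)%N| <= (K * q ^ j)%N%:Z.

Let y : R := ln q%:R.
Let x : R := ln D%:R.
Let W : {poly C} := \poly_(n < D) (A n)%:~R.

Lemma nrm_int (z : int) : nrm z%:~R = `|z|%:~R.
Proof. by rewrite -(rmorph_int (real_complex R)) nrm_real intr_norm. Qed.

Lemma q_gt0 : 0 < q%:R :> R. Proof. by rewrite ltr0n (ltn_trans _ q1). Qed.

Lemma expR_y : expR y = q%:R. Proof. by rewrite /y lnK // posrE q_gt0. Qed.
Lemma expR_x : expR x = D%:R. Proof. by rewrite /x lnK // posrE ltr0n ltnW. Qed.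

Lemma y_ge : 2 / 3 <= y.
Proof.
have : expR (- y) <= 3^-1.
  by rewrite expRN expR_y lef_pV2 ?posrE ?q_gt0 // ler_nat.
by have := expR_ge1Dx (- y); lra.
Qed.

Lemma W_split : exists2 s : seq C, W = \prod_(a <- s) (1 - a *: 'X) & (size s <= D)%N.
Proof.
have [|s E sz] := @split_one_sub C W.
  by rewrite horner_coef0 coef_poly (ltnW D1) A0.
exists s => //; apply: ltnW; apply: leq_trans sz _; exact: size_poly.
Qed.

Section Roots.
Variable s : seq C.
Hypothesis Ws : W = \prod_(a <- s) (1 - a *: 'X).

Lemma S_power_sum k : (S k.+1)%:~R = - \sum_(a <- s) a ^+ k.+1 :> C.
Proof.
apply: (@power_sums_eq C s (fun n => (A n)%:~R) (fun n => (S n)%:~R)).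
- by rewrite A0.
- move=> n; rewrite -Ws coef_poly; case: ltnP => // Dn; by rewrite A_vanish.
- move=> n; have := A_rec n => /(congr1 (fun z : int => z%:~R : C)).
  rewrite rmorphM /= => ->; rewrite rmorph_sum /= big_add1 /= big_mkord.
  by apply: eq_bigr => i _; rewrite rmorphM.
Qed.

(** Only even power sums are controlled, so [power_sum_bound] is applied to the squares of the
    inverse roots, with growth rate q. *)
Lemma root_bound a : a \in s -> nrm a <= expR (y / 2).
Proof.
move=> sa; have e0 : 0 <= expR (y / 2) by apply: expR_ge0.
rewrite -(@ler_pXn2r _ 2) // ?nnegrE ?nrm_ge0 // -nrmX.
have -> : expR (y / 2) ^+ 2 = q%:R by rewrite expr2 -expRD -expR_y; congr expR; field.
apply: (@power_sum_bound R [seq a ^+ 2 | a <- s] _ K%:R j0.+1 q_gt0); last first.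
  by apply/mapP; exists a.
move=> [//|j] jj; rewrite big_map.
have -> : \sum_(b <- s) b ^+ 2 ^+ j.+1 = - (S (j.+1 + j.+1)%N)%:~R.
  rewrite addSn S_power_sum opprK; apply: eq_bigr => b _; rewrite -exprM.
  by congr (_ ^+ _); lia.
rewrite nrmN nrm_int -natrX -natrM -[(_ * _)%N%:R]/((_ * _)%N%:Z%:~R) ler_int.
by apply: S_even; apply: ltnW.
Qed.

Variable u : C.
Hypothesis u_norm : nrm u = expR (- (y / 2)).
Variable N : nat.
Hypothesis N_le : N%:R * y <= x.

Lemma W_bound : (size s <= D)%N ->
  nrm W.[u] <= expR (5 / 2 * D%:R / N.+1%:R + N%:R * expR (x / 2)).
Proof.
move=> sD; rewrite Ws horner_prod nrm_prod.
pose r : R := N.+2%:R / (N.+2%:R + 4).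
pose kap (k : nat) : R := N.+1%:R^-1 * (N - k)%:R / k.+1%:R * r ^+ k.+1.
have r0 : 0 <= r by rewrite divr_ge0 // addr_ge0.
have r1 : r <= 1.
  rewrite ler_pdivrMr ?mul1r ?lerDl // ltr_pwDr //.
have kap0 k : 0 <= kap k by rewrite /kap !mulr_ge0 ?invr_ge0 ?exprn_ge0.
have kap1 k : kap k <= 1.
  rewrite /kap -[X in _ <= X]mul1r ler_pM ?exprn_ge0 ?exprn_ile1 //.
  rewrite ler_pdivrMr ?ltr0n // mul1r ler_pdivrMl ?ltr0n // -natrM ler_nat.
  by nia.
have uu a : a \in s -> nrm (1 - a * u) <= expR (5 / 2 * N.+1%:R^-1 - \sum_(k < N) kap k * complex.Re ((a * u) ^+ k.+1)).
  move=> sa; have w1 : nrm (a * u) <= 1.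
    rewrite nrmM u_norm -[X in _ <= X](expRxMexpNx_1 (y / 2)) ler_wpM2r ?expR_ge0 //.
    exact: root_bound.
  have := majorant N w1; rewrite horner_sum => H; apply: le_trans H _.
  rewrite ler_expR lerD2l lerN2; apply: ler_sum => k _.
  by rewrite hornerZ hornerXn /kap -/r mulrAC.
apply: (@le_trans _ _ (\prod_(a <- s) expR (5 / 2 * N.+1%:R^-1 - \sum_(k < N) kap k * complex.Re ((a * u) ^+ k.+1)))).
  rewrite !big_seq; apply: ler_prod => a sa; rewrite nrm_ge0 !hornerE; exact: uu.
rewrite -expR_sum ler_expR sumrB lerD //.
  rewrite big_const_seq count_predT iter_addr_0 -[X in X <= _]mulr_natr -!mulrA ler_wpM2l // ler_wpM2l //.
  by rewrite mulrC ler_wpM2r ?invr_ge0 // ler_nat.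
(* Term by term, |S_k u^k| <= q^(k/2) <= q^(N/2) <= sqrt(D). *)
rewrite exchange_big /= -sumrN; apply: (@le_trans _ _ (\sum_(k < N) expR (x / 2))); last first.
  by rewrite sumr_const card_ord mulr_natl.
apply: ler_sum => k _; rewrite -mulr_sumr -Re_sum.
have -> : \sum_(a <- s) (a * u) ^+ k.+1 = - ((S k.+1)%:~R * u ^+ k.+1).
  by rewrite S_power_sum mulNr opprK mulr_suml; apply: eq_bigr => a _; rewrite exprMn.
apply: le_trans (ler_norm _) _; rewrite normrN normrM ger0_norm //.
apply: (@le_trans _ _ (1 * nrm (- ((S k.+1)%:~R * u ^+ k.+1)))).
  by rewrite ler_pM // Re_le.
rewrite mul1r nrmN nrmM nrmX nrm_int u_norm.
apply: (@le_trans _ _ (expR (k.+1%:R * y) * expR (- (y / 2)) ^+ k.+1)).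
  rewrite ler_wpM2r ?exprn_ge0 ?expR_ge0 // expRM_natl expR_y -natrX.
  by rewrite -[_%:R]/((_ ^ _)%N%:Z%:~R) ler_int S_le.
rewrite -expRM_natl -expRD ler_expR.
have : k.+1%:R * y <= N%:R * y.
  by apply: ler_wpM2r; [have := y_ge; lra | rewrite ler_nat].
by move: N_le; lra.
Qed.

End Roots.

(* AM-GM in the form (1 + v)^3 >= 27 v / 4, with v = x / 12. *)
Lemma sqr_le_expR : x ^+ 2 <= 10 / 3 * expR (x / 2).
Proof.
have x0 : 0 <= x by rewrite ln_ge0 // ler1n ltnW.
pose v := x / 12.
have v0 : 0 <= v by rewrite divr_ge0.
have H1 : 27 / 4 * v <= (1 + v) ^+ 3.
  rewrite -subr_ge0 (_ : _ - _ = (v - 1 / 2) ^+ 2 * (v + 4)); last by field.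
  apply: mulr_ge0; first exact: sqr_ge0.
  by rewrite addr_ge0.
have H2 : (1 + v) ^+ 3 <= expR (x / 4).
  have -> : x / 4 = 3%:R * v by rewrite /v; field.
  by rewrite expRM_natl lerXn2r ?nnegrE ?expR_ge0 ?addr_ge0 // expR_ge1Dx.
have H3 : x <= 16 / 9 * expR (x / 4).
  have xe : x = 16 / 9 * (27 / 4 * v) by rewrite /v; field.
  rewrite [X in X <= _]xe.
  by rewrite ler_pM2l ?divr_gt0 // (le_trans H1).
have -> : expR (x / 2) = expR (x / 4) ^+ 2 by rewrite expr2 -expRD; congr expR; field.
apply: (@le_trans _ _ ((16 / 9 * expR (x / 4)) ^+ 2)).
  by rewrite lerXn2r // nnegrE // mulr_ge0 ?expR_ge0 // divr_ge0.
by rewrite exprMn ler_wpM2r ?sqr_ge0 //; lra.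
Qed.

Lemma L_bound (u : C) : nrm u = expR (- (y / 2)) ->
  nrm W.[u] <= expR (10 / x * (D%:R * y)).
Proof.
move=> un; have y23 := y_ge; have y0 : 0 < y by lra.
have x0 : 0 < x by rewrite ln_gt0 // ltr1n.
pose N := Num.Def.truncn (x / y).
have /andP[N1 N2] := truncn_itv (divr_ge0 (ltW x0) (ltW y0)).
have NX : N%:R * y <= x by rewrite -ler_pdivlMr.
have XN : x <= N.+1%:R * y by rewrite -ler_pdivrMr // ltW.
have [s Ws sD] := W_split.
apply: le_trans (W_bound Ws un NX sD) _; rewrite ler_expR.

set e := expR (x / 2); have e0 : 0 < e by apply: expR_gt0.
have De : D%:R = e ^+ 2 by rewrite /e expr2 -expRD -expR_x; congr expR; field.
have D0 : 0 < D%:R :> R by rewrite ltr0n ltnW.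
have T1 : 5 / 2 * D%:R / N.+1%:R <= 5 / 2 / x * (D%:R * y).
  have -> : 5 / 2 / x * (D%:R * y) = 5 / 2 * D%:R * (y / x) by field; rewrite gt_eqF.
  rewrite ler_wpM2l ?mulr_ge0 ?(ltW D0) //.
  by rewrite ler_pdivlMr // mulrC ler_pdivrMr ?ltr0n // mulrC.
(* This reduces to x^2 <= (15/2) y^2 sqrt(D); since y >= 2/3, the factor (15/2) y^2 is at least the
   10/3 of [sqr_le_expR]. *)
have T2 : N%:R * e <= (15 / 2) / x * (D%:R * y).
  apply: (@le_trans _ _ (x / y * e)); first by rewrite ler_pM2r.
  rewrite De -subr_ge0.
  have -> : 15 / 2 / x * (e ^+ 2 * y) - x / y * e = e / (x * y) * (15 / 2 * y ^+ 2 * e - x ^+ 2).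
    by field; rewrite !gt_eqF.
  rewrite mulr_ge0 ?divr_ge0 ?mulr_ge0 ?(ltW e0) ?(ltW x0) ?(ltW y0) // subr_ge0.
  apply: le_trans sqr_le_expR _; rewrite -/e ler_pM2r //.
  by nra.
have -> : 10 / x * (D%:R * y) = 5 / 2 / x * (D%:R * y) + 15 / 2 / x * (D%:R * y) by field; rewrite gt_eqF.
exact: lerD.
Qed.
End RiemannHypothesisBound.

(** * From the Kronecker symbol to the values of L *)

Section Kronecker.
Variables (F : finFieldType) (K : closedFieldType) (io : {rmorphism F -> K}).
Hypothesis odd_char : 2%N \notin [pchar F].
Variables (d : {poly F}) (chi : {poly F} -> int).
Hypothesis chi_d : is_kronecker d chi.

Lemma symb_legendre p : p \is monic -> irreducible_poly p -> legendre_at d p = symb io d p.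
Proof.
move=> mp ip; have [rz rnz r1] := symb_irreducible io odd_char d mp ip.
rewrite /legendre_at; case: ifP => [/rz ->//|/negbT pd].
case: asboolP => [/(r1 pd) ->//|H].
have := rnz pd; have : symb io d p <> 1 by move/(r1 pd).
rewrite /symb /quadchar; case: (_ == 0) => //; by case: (_ == 1).
Qed.

Lemma chi_symb m : m \is monic -> chi m = symb io d m.
Proof.
have [chi1 chiM chiI] := chi_d.
elim: {m}(size m) {-2}m (leqnn (size m)) => [|n IH] m sm mm.
  by move: sm; rewrite leqn0 size_poly_eq0 (negPf (monic_neq0 mm)).
have [s1|s1] := leqP (size m) 1.
  have [c _ E] : exists2 c, c != 0 & m = c%:P.
    by apply/size_poly1P; rewrite eqn_leq s1 size_poly_gt0 monic_neq0.
  move: mm; rewrite E monicE lead_coefC => /eqP ->.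
  by rewrite chi1 symb1.
have [p [mp ip /dvdpP[m' E]]] := irr_factor io s1.
have mm' : m' \is monic by move: mm; rewrite E mulrC monicMl.
rewrite E chiM // symbM // (chiI p) // (symb_legendre mp ip) IH //.
have := sm; rewrite E size_mul ?monic_neq0 //.
by case: ip; case: (size p) => [|[|k]] // _ _; rewrite !addnS /= ltnS; apply: leq_trans; rewrite leq_addr.
Qed.

Lemma sum_chi_monic n : \sum_(c : {ffun 'I_n -> F}) chi (monic_of c) = Lcoef io d n.
Proof.
rewrite /Lcoef /monics big_map big_enum /=; apply: eq_bigr => c _.
by rewrite chi_symb // monic_ofP.
Qed.

Variable R : realType.
Variable t : R.
Local Notation C := R[i].
Let y : R := ln #|F|%:R.
(** This is q^(-s) at s = 1/2 + it. *)
Let u : C := ((expR (- (y / 2)) * cos (t * y)) +i* (- (expR (- (y / 2)) * sin (t * y))))%C.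

Lemma uX n : u ^+ n = ((expR (- 2^-1 * (n%:R * y)) * cos (t * (n%:R * y)))
   +i* (- (expR (- 2^-1 * (n%:R * y)) * sin (t * (n%:R * y)))))%C.
Proof.
elim: n => [|n IH].
  by rewrite expr0 !(mul0r, mulr0) expR0 cos0 sin0 mulr1 mulr0 oppr0.
rewrite exprS IH.
have -> : - 2^-1 * (n.+1%:R * y) = - (y / 2) + - 2^-1 * (n%:R * y) by rewrite -natr1; field.
have -> : t * (n.+1%:R * y) = t * y + t * (n%:R * y) by rewrite -natr1; ring.
rewrite expRD cosD sinD; apply/eqP; rewrite eq_complex /=.
by apply/andP; split; apply/eqP; ring.
Qed.

Lemma nrm_u : Normc.normc u = expR (- (y / 2)).
Proof.
apply/eqP; rewrite -(@eqrXn2 _ 2) ?nrm_ge0 ?expR_ge0 // nrm_sqr /= sqrrN !exprMn -mulrDr.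
by rewrite cos2Dsin2 mulr1.
Qed.

Lemma ln_absq n : ln (absq F R n) = n%:R * y.
Proof. by rewrite /absq natrX lnXn ?mulr_natl // ltr0n (ltnW (card_gt1 F)). Qed.

Lemma Lpartial_reE N : Lpartial_re chi 2^-1 t N = complex.Re (\sum_(n < N) (Lcoef io d n)%:~R * u ^+ n).
Proof.
rewrite Re_sum; apply: eq_bigr => n _.
rewrite -!mulr_suml -(rmorph_int (real_complex R)) ReZ uX /= ln_absq -sum_chi_monic.
by rewrite rmorph_sum -mulrA.
Qed.

Lemma Lpartial_imE N : Lpartial_im chi 2^-1 t N = complex.Im (\sum_(n < N) (Lcoef io d n)%:~R * u ^+ n).
Proof.
rewrite raddf_sum; apply: eq_bigr => n _.
rewrite sumrN -!mulr_suml -(rmorph_int (real_complex R)) uX /= ln_absq -sum_chi_monic.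
by rewrite rmorph_sum mul0r addr0 mulrN -mulrA.
Qed.

Lemma L_absE D : (forall n, (D <= n)%N -> Lcoef io d n = 0) ->
  L_abs chi 2^-1 t = Normc.normc (\poly_(n < D) ((Lcoef io d n)%:~R : C)).[u].
Proof.
move=> A0; pose z := \sum_(n < D) (Lcoef io d n)%:~R * u ^+ n.
have zN N : (D <= N)%N -> \sum_(n < N) (Lcoef io d n)%:~R * u ^+ n = z.
  move=> DN; rewrite /z (big_ord_widen _ (fun n => (Lcoef io d n)%:~R * u ^+ n) DN) [RHS]big_mkcond.
  by apply: eq_bigr => n _; case: ltnP => // /A0 ->; rewrite mul0r.
have -> : (\poly_(n < D) ((Lcoef io d n)%:~R : C)).[u] = z by rewrite horner_poly.
have re : L_re chi 2^-1 t = complex.Re z.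
  apply/cvg_lim => //; apply: cvg_near_cst; exists D => // n /= Dn.
  by rewrite Lpartial_reE zN.
have im : L_im chi 2^-1 t = complex.Im z.
  apply/cvg_lim => //; apply: cvg_near_cst; exists D => // n /= Dn.
  by rewrite Lpartial_imE zN.
by rewrite /L_abs re im; case: (z).
Qed.
End Kronecker.

Theorem theoremA1 (F : finFieldType) (R : realType)
  (d : {poly F}) (chi : {poly F} -> int) (t : R) :
  ~~ (2%N \in [pchar F]) ->
  squarefree d ->
  (3 <= (size d).-1)%N ->
  is_kronecker d chi ->
  L_abs chi (2^-1) t <
    4 * powR (((#|F| ^ (size d).-1)%N)%:R : R) (10 / ln (((size d).-1)%:R : R)).
Proof.
move=> ch [d0 sqf] D3 chi_d.
have [K [io _]] := countable_algebraic_closure F.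
have d1 : (1 < size d)%N by case: (size d) D3 => [|[]].
have A0 := Lcoef_vanish io ch d0 sqf d1.
have q3 : (2 < #|F|)%N.
  by have := card_odd io ch; have := card_gt1 F; case: #|F| => [|[|[]]].
(* From q^j > j >= 2D + 6, half of q^j is at least D + 3, which meets both size conditions of
   [charsum_bound]. *)
have SE j : ((2 * (size d).-1 + 6) <= j)%N ->
    `|charsum io d (j + j)| <= ((7 * (size d).-1 + 6) * #|F| ^ j)%N%:Z.
  move=> jD; have jq : (j < #|F| ^ j)%N := ltn_expl j (card_gt1 F).
  by apply: (charsum_bound io ch d0 sqf d1); move: jq jD; move: (#|F| ^ j)%N; lia.
rewrite (L_absE ch chi_d t A0).
have H := @L_bound R _ _ _ _ q3 (ltnW D3) (Lcoef0 io d) A0 (Lcoef_rec io ch d) (@charsum_le _ _ io d) _ _ SE _ (nrm_u F t).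
apply: le_lt_trans H _.
have q0 : 0 < #|F|%:R :> R by rewrite ltr0n (ltnW (card_gt1 F)).
set P := powR _ _; have -> : P = expR (10 / ln (size d).-1%:R * ((size d).-1%:R * ln #|F|%:R)).
  by rewrite /P /powR natrX gt_eqF ?exprn_gt0 // lnXn // [_.-1%:R * _]mulr_natl.
(* The bound was reached with constant 1; strictness comes from 1 < 4. *)
by rewrite ltr_pMl ?expR_gt0 // ltr1n.
Qed.
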